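(* Let $T\in\mathcal G_{L,p}(1)$ and $S\in\mathcal G_{L,p}(2)$ be ternary $\mathbb Z$-lattices satisfying $r(T^p,S)\neq0$. Then for every integer $n$, $$\begin{aligned}(3p^2-p)\cdot r(n,T)=&\sum_{[\tilde S]\in\mathrm{gen}(S)}\frac{\tilde r(\tilde S^p,T)}{o(\tilde S)}\left(\frac{3p}2\,r(pn,\tilde S)-\frac p{p-1}\,r(p^3n,\tilde S)\right)\\ &+\frac1{p-1}\left(o(\Gamma_{p,1}(T))\sum_{\substack{[\tilde S]\in\mathrm{gen}(S)\\ \lambda_p(\tilde S)\simeq\Gamma_{p,1}(T)^{1/p}}}\frac{r(p^3n,\tilde S)}{o(\tilde S)}+o(\Gamma_{p,2}(T))\sum_{\substack{[\tilde S]\in\mathrm{gen}(S)\\ \lambda_p(\tilde S)\simeq\Gamma_{p,2}(T)^{1/p}}}\frac{r(p^3n,\tilde S)}{o(\tilde S)}\right).\end{aligned}$$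
   Context: Lattices: a ($\mathbb Z$-)lattice is a free $\mathbb Z$-module of finite rank spanning a positive definite quadratic space over $\mathbb Q$ with bilinear form $B$ and $Q(x)=B(x,x)$, always assumed non-classic integral: $Q(x)\in\mathbb Z$ for all lattice vectors $x$. For a rational $a>0$, $M^a$ is $M$ with its form multiplied by $a$. $r(n,M)=|\{x\in M: Q(x)=n\}|$; $r(M,N)$ is the number of $\mathbb Z$-linear maps $M\to N$ preserving $B$; $\tilde r(M,N)$ is the number of such maps $\sigma$ with $N/\sigma(M)\simeq\mathbb Z/p\mathbb Z\oplus\mathbb Z/p\mathbb Z$. $o(M)=|O(M)|$ is the order of the isometry group, $[M]$ the isometry class, $\mathrm{gen}(M)$ the genus; sums over $[\tilde S]\in\mathrm{gen}(S)$ run over isometry classes in the genus. Setting: $p$ is a prime and $L$ is a ternary lattice with $L_p\simeq \begin{pmatrix}0&\frac12\\ \frac12&0\end{pmatrix}\perp\langle\epsilon\rangle$, $\epsilon\in\mathbb Z_p^\times$. For $m\ge 0$, $\mathcal G_{L,p}(m)$ is the genus of ternary lattices $T$ such that $T_p\simeq \begin{pmatrix}0&\frac12\\ \frac12&0\end{pmatrix}\perp\langle\epsilon p^m\rangle$ and $T_q\simeq (L^{p^m})_q$ for all primes $q\ne p$ (it lies on $V=\mathbb Q\otimes L$ if $m$ is even and on $V^p$ if $m$ is odd). Every $T\in\mathcal G_{L,p}(m+1)$ ($m\ge0$) has exactly two sublattices of index $p$ on which all values of $Q$ are divisible by $p$, denoted $\Gamma_{p,1}(T),\Gamma_{p,2}(T)$;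 one has $\Gamma_{p,i}(T)^{1/p}\in\mathcal G_{L,p}(m)$. $\Lambda_p(M)=\{x\in M: Q(x+z)\equiv Q(z)\pmod p\text{ for all }z\in M\}$, and for $M\in\mathcal G_{L,p}(k)$ with $k\ge2$, $\lambda_p(M)=\Lambda_p(M)^{1/p^2}\in\mathcal G_{L,p}(k-2)$. *)

(* Defs.v *)
From HB Require Import structures.
From mathcomp Require Import all_boot all_order all_algebra finmap.
From mathcomp Require Import boolp classical_sets functions cardinality fsbigop.

Set Implicit Arguments.
Unset Strict Implicit.
Unset Printing Implicit Defensive.

Import Order.TTheory GRing.Theory Num.Theory.
Local Open Scope classical_set_scope.
Local Open Scope ring_scope.

(* As in 'F_p, an index that is not prime is replaced by a prime (here 2), so
   that Zadic p is an integral domain for every p. *)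
Definition padic_prime (p : nat) : nat := if prime p then p else 2.

Lemma padic_primeP p : prime (padic_prime p).
Proof. by rewrite /padic_prime; case: ifP. Qed.

Lemma padic_primeE p : prime p -> padic_prime p = p.
Proof. by rewrite /padic_prime => ->. Qed.

Definition pmod (p k : nat) : int := (padic_prime p)%:Z ^+ k.

Lemma pmod_neq0 p k : pmod p k != 0.
Proof.
by rewrite expf_neq0 // eqz_nat -lt0n prime_gt0 // padic_primeP.
Qed.

Lemma pmod_mod p k (x : int) :
  ((x %% pmod p k.+1)%Z = x %[mod pmod p k])%Z.
Proof.
rewrite [in RHS](divz_eq x (pmod p k.+1)).
by rewrite [X in (_ * X + _)%R](exprS (padic_prime p)%:Z k) mulrA modzMDl.
Qed.

(* Z_p as the inverse limit of the rings Z/p^k Z, with residues represented in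
   [0, p^k[. *)
Record Zadic (p : nat) := MkZadic {
  zpval :> nat -> int;
  zpvalP : forall k, zpval k = (zpval k.+1 %% pmod p k)%Z }.

HB.instance Definition _ p := gen_eqMixin (Zadic p).
HB.instance Definition _ p := gen_choiceMixin (Zadic p).

Section ZpRing.
Variable p : nat.
Implicit Types x y z : Zadic p.

Lemma zp_eq x y : (forall k, (x k = y k %[mod pmod p k])%Z) -> x = y.
Proof.
have red (z : Zadic p) k : (z k %% pmod p k)%Z = z k.
  by rewrite zpvalP modz_mod.
case: x y red => [x xP] [y yP] red xy.
have exy : x = y.
  apply: funext => k; have := xy k.
  by rewrite (red (MkZadic xP)) (red (MkZadic yP)).
by subst y; congr MkZadic; exact: Prop_irrelevance.
Qed.

Lemma zp_mod x k : (x k %% pmod p k)%Z = x k.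
Proof. by rewrite zpvalP modz_mod. Qed.

Lemma zp_coh x k : (x k.+1 = x k %[mod pmod p k])%Z.
Proof. by rewrite [x k]zpvalP modz_mod. Qed.

Lemma mk_subproof (f : nat -> int) :
  (forall k, (f k.+1 = f k %[mod pmod p k])%Z) ->
  forall k, (f k %% pmod p k)%Z = ((f k.+1 %% pmod p k.+1)%Z %% pmod p k)%Z.
Proof. by move=> fP k; rewrite pmod_mod fP. Qed.

Definition mk (f : nat -> int)
    (fP : forall k, (f k.+1 = f k %[mod pmod p k])%Z) : Zadic p :=
  MkZadic (mk_subproof fP).

Fact int_coh (c : int) k : ((fun=> c) k.+1 = (fun=> c) k %[mod pmod p k])%Z.
Proof. by []. Qed.

Fact add_coh x y k : (x k.+1 + y k.+1 = x k + y k %[mod pmod p k])%Z.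
Proof. by rewrite -modzDml zp_coh modzDml -modzDmr zp_coh modzDmr. Qed.

Fact mul_coh x y k : (x k.+1 * y k.+1 = x k * y k %[mod pmod p k])%Z.
Proof. by rewrite -modzMml zp_coh modzMml -modzMmr zp_coh modzMmr. Qed.

Fact opp_coh x k : (- x k.+1 = - x k %[mod pmod p k])%Z.
Proof. by rewrite -modzNm zp_coh modzNm. Qed.

Definition zp0 : Zadic p := mk (int_coh 0).
Definition zp1 : Zadic p := mk (int_coh 1).
Definition zp_add x y : Zadic p := mk (add_coh x y).
Definition zp_mul x y : Zadic p := mk (mul_coh x y).
Definition zp_opp x : Zadic p := mk (opp_coh x).

Fact zp_addA : associative zp_add.
Proof.
by move=> x y z; apply: zp_eq => k /=; rewrite !modz_mod modzDmr modzDml addrA.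
Qed.
Fact zp_addC : commutative zp_add.
Proof. by move=> x y; apply: zp_eq => k /=; rewrite addrC. Qed.
Fact zp_add0 : left_id zp0 zp_add.
Proof. by move=> x; apply: zp_eq => k /=; rewrite modz_mod modzDml add0r. Qed.
Fact zp_addN : left_inverse zp0 zp_opp zp_add.
Proof.
by move=> x; apply: zp_eq => k /=; rewrite !modz_mod modzDml addNr.
Qed.
Fact zp_mulA : associative zp_mul.
Proof.
by move=> x y z; apply: zp_eq => k /=; rewrite !modz_mod modzMmr modzMml mulrA.
Qed.
Fact zp_mulC : commutative zp_mul.
Proof. by move=> x y; apply: zp_eq => k /=; rewrite mulrC. Qed.
Fact zp_mul1 : left_id zp1 zp_mul.
Proof. by move=> x; apply: zp_eq => k /=; rewrite modz_mod modzMml mul1r. Qed.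
Fact zp_mulD : left_distributive zp_mul zp_add.
Proof.
move=> x y z; apply: zp_eq => k /=.
by rewrite !modz_mod modzMml modzDml modzDmr mulrDl.
Qed.
Fact zp_1neq0 : zp1 != zp0.
Proof.
apply/eqP => /(congr1 (fun x : Zadic p => zpval x 1)) /=.
rewrite /pmod expr1 mod0z modz_small //=.
by rewrite ltz_nat prime_gt1 // padic_primeP.
Qed.

HB.instance Definition _ :=
  GRing.isZmodule.Build (Zadic p) zp_addA zp_addC zp_add0 zp_addN.
HB.instance Definition _ :=
  GRing.Zmodule_isComNzRing.Build (Zadic p) zp_mulA zp_mulC zp_mul1 zp_mulD zp_1neq0.

Definition zp_unit : pred (Zadic p) := fun x => `[< exists y, y * x = 1 >].
Definition zp_inv x : Zadic p := if zp_unit x then xget 0 [set y | y * x = 1] else x.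

Fact zp_mulV : {in zp_unit, left_inverse 1 zp_inv *%R}.
Proof.
move=> x xU; have xU' : zp_unit x by [].
rewrite /zp_inv xU'; move/asboolP: xU' => xu.
exact: (@xgetPex _ 0 [set y | y * x = 1]).
Qed.
Fact zp_unitP x y : y * x = 1 -> zp_unit x.
Proof. by move=> yx; apply/asboolP; exists y. Qed.
Fact zp_inv_out : {in [predC zp_unit], zp_inv =1 id}.
Proof.
move=> x xU; have xU' : ~~ zp_unit x by [].
by rewrite /zp_inv (negbTE xU').
Qed.

HB.instance Definition _ :=
  GRing.ComNzRing_hasMulInverse.Build (Zadic p) zp_mulV zp_unitP zp_inv_out.

Lemma zp_cohD x k j : (x (k + j)%N = x k %[mod pmod p k])%Z.
Proof.
elim: j => [|j IHj]; first by rewrite addn0.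
rewrite addnS -IHj [x (k + j)%N]zpvalP.
rewrite /pmod exprD; apply/esym/eqP; rewrite eqz_mod_dvd.
set d := _ ^+ k; set m := _ * _.
have : (m %| (x (k + j).+1 %% m)%Z - x (k + j).+1)%Z.
  by rewrite -eqz_mod_dvd modz_mod.
by apply: dvdz_trans; exact: dvdz_mulr.
Qed.

Fact zp_idomain x y : x * y = 0 -> (x == 0) || (y == 0).
Proof.
move=> xy0; apply/orP.
have nz (z : Zadic p) : z != 0 -> exists k, ~~ (pmod p k %| z k)%Z.
  move=> z0; apply: contrapT => /forallNP zk; case/eqP: z0; apply: zp_eq => k /=.
  rewrite mod0z mod0z; apply/eqP; have /negP := zk k.
  by rewrite negbK => /dvdz_mod0P ->.
have [x0|/nz [i xi]] := boolP (x == 0); [by left|right].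
have [//|/nz [j yj]] := boolP (y == 0); exfalso.
have pd (z : Zadic p) (a b : nat) : (pmod p a %| z (a + b)%N)%Z = (pmod p a %| z a)%Z.
  by apply/dvdz_mod0P/dvdz_mod0P; rewrite zp_cohD.
have pP := padic_primeP p.
have : (pmod p (i + j) %| x (i + j)%N * y (i + j)%N)%Z.
  apply/dvdz_mod0P; have := congr1 (fun z : Zadic p => zpval z (i + j)%N) xy0.
  by rewrite /= => ->; rewrite mod0z.
rewrite -(pd x i j) in xi.
rewrite -(pd y j i) addnC in yj.
move: (x _) (y _) xi yj => {xy0} a b xi yj.
rewrite /pmod !dvdzE !abszX absz_nat in xi yj *.
rewrite abszM => ab.
have a0 : (0 < `|a|)%N by case: `|a|%N xi => //; rewrite dvdn0.
have b0 : (0 < `|b|)%N by case: `|b|%N yj => //; rewrite dvdn0.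
move: ab xi yj; rewrite !pfactor_dvdn ?muln_gt0 ?a0 // lognM // -!ltnNge => ab xi yj.
suff : (i + j < i + j)%N by rewrite ltnn.
apply: leq_ltn_trans ab _; rewrite -addnS.
by apply: leq_add; first exact: ltnW.
Qed.

HB.instance Definition _ :=
  GRing.ComUnitRing_isIntegral.Build (Zadic p) zp_idomain.

End ZpRing.

Definition Qadic (p : nat) := {fraction (Zadic p)}.
HB.instance Definition _ p := GRing.Field.on (Qadic p).

(* A lattice of rank n on the quadratic space (Q^n, form): the Z-span of the
   rows of [basis]. Different bases may have the same [carrier]. *)
Record lattice (n : nat) := MkLattice {
  form : 'M[rat]_n;
  basis : 'M[rat]_n;
  form_sym : form^T = form;
  form_pos : forall x : 'rV[rat]_n, x != 0 -> 0 < (x *m form *m x^T) 0 0;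
  basis_unit : basis \in unitmx }.

HB.instance Definition _ n := gen_eqMixin (lattice n).
HB.instance Definition _ n := gen_choiceMixin (lattice n).

Section Lattices.
Variable n : nat.
Implicit Types M N K S T : lattice n.

Definition carrier M : set 'rV[rat]_n :=
  [set map_mx intr v *m basis M | v in [set: 'rV[int]_n]].

Definition B M (x y : 'rV[rat]_n) : rat := (x *m form M *m y^T) 0 0.
Definition Q M (x : 'rV[rat]_n) : rat := B M x x.

Definition integral M := forall x, carrier M x -> Q M x \is a Num.int.

(* M^a; only used for a > 0. *)
Definition scale_coef (a : rat) : rat := if 0 < a then a else 1.

Fact scale_coef_gt0 a : 0 < scale_coef a.
Proof. by rewrite /scale_coef; case: ifP. Qed.

Fact scale_sym a M : (scale_coef a *: form M)^T = scale_coef a *: form M.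
Proof. by rewrite linearZ /= form_sym. Qed.

Fact scale_pos a M (x : 'rV[rat]_n) :
  x != 0 -> 0 < (x *m (scale_coef a *: form M) *m x^T) 0 0.
Proof.
move=> x0; rewrite -scalemxAr -scalemxAl mxE.
by rewrite mulr_gt0 ?scale_coef_gt0 // form_pos.
Qed.

Definition scale (a : rat) M : lattice n :=
  MkLattice (scale_sym a M) (scale_pos a M) (basis_unit M).

(* Linear maps act on row vectors by x |-> x *m X. A Z-linear map between the
   carriers extends uniquely to the ambient Q-spaces, so it is a matrix X. *)
Definition preserves_form M N (X : 'M[rat]_n) :=
  forall x y, B N (x *m X) (y *m X) = B M x y.

Definition image_lattice (X : 'M[rat]_n) M : set 'rV[rat]_n :=
  [set x *m X | x in carrier M].

Definition representations M N : set 'M[rat]_n :=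
  [set X | preserves_form M N X /\ image_lattice X M `<=` carrier N].

Definition isometries M N : set 'M[rat]_n :=
  [set X | preserves_form M N X /\ image_lattice X M = carrier N].

Definition isometric M N := exists X, isometries M N X.

(* N / K is isomorphic to Z/p + Z/p: an isomorphism is an additive surjection
   on N with kernel K ('Z_p is Z/p only for p > 1). *)
Definition quotient_ZpxZp (p : nat) N (K : set 'rV[rat]_n) :=
  exists f : 'rV[rat]_n -> 'Z_p * 'Z_p,
    [/\ forall x y, carrier N x -> carrier N y -> f (x + y) = f x + f y,
        forall z, exists2 x, carrier N x & f x = z &
        forall x, carrier N x -> (f x = 0 <-> K x)].

(* The sets counted below are finite because the forms are positive definite
   (fset_set sends an infinite set to the empty one). *)
Definition r (k : int) M : nat :=
  #|` fset_set [set x | carrier M x /\ Q M x = k%:~R] |.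

Definition r_lat M N : nat := #|` fset_set (representations M N) |.

Definition r_tilde (p : nat) M N : nat :=
  #|` fset_set [set X | representations M N X /\
                        quotient_ZpxZp p N (image_lattice X M)] |.

Definition o M : nat := #|` fset_set (isometries M M) |.

Definition gram_at (q : nat) M : 'M[Qadic q]_n :=
  map_mx ratr (basis M *m form M *m (basis M)^T).

(* Gram matrices over Q_q of isometric Z_q-lattices. *)
Definition Zadic_equiv (q : nat) (A A' : 'M[Qadic q]_n) :=
  exists2 U : 'M[Zadic q]_n, U \in unitmx &
    map_mx (@FracField.tofrac (Zadic q)) U *m A
      *m (map_mx (@FracField.tofrac (Zadic q)) U)^T = A'.

Definition isometric_at (q : nat) M N := Zadic_equiv (gram_at q M) (gram_at q N).

(* The lattices need not lie on the same matrix form: only isometry classes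
   matter, and spaces that are locally isometric everywhere are isometric. *)
Definition genus M : set (lattice n) :=
  [set N | integral N /\ forall q, prime q -> isometric_at q N M].

Definition iso_class M : set (lattice n) := [set N | isometric M N].

(* Sum of F, evaluated at representatives in A, over the isometry classes
   meeting A; it is meant for F invariant under isometry. No A `&` c is empty,
   so the default value S0 of xget is not used. *)
Definition class_sum (S0 : lattice n) (A : set (lattice n))
    (F : lattice n -> rat) : rat :=
  \sum_(c \in [set iso_class M | M in A]) F (xget S0 (A `&` c)).

Definition index_eq (k : nat) M K :=
  ([set [set x + y | y in carrier K] | x in carrier M] #= `I_k)%card.

Definition is_Gamma (p : nat) T K :=
  [/\ form K = form T, carrier K `<=` carrier T, index_eq p T K &
      forall x, carrier K x -> exists m : int, Q T x = (p%:Z * m)%:~R].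

Definition Lambda_set (p : nat) M : set 'rV[rat]_n :=
  [set x | carrier M x /\ forall z, carrier M z ->
     exists m : int, Q M (x + z) - Q M z = (p%:Z * m)%:~R].

(* For M integral and p > 0 this is a subgroup containing pM, hence a lattice,
   so that the default value M of xget is not used. *)
Definition Lambda (p : nat) M : lattice n :=
  xget M [set K | form K = form M /\ carrier K = Lambda_set p M].

Definition lambda (p : nat) M : lattice n := scale (p%:R ^- 2) (Lambda p M).

End Lattices.

(* Gram matrix of the hyperbolic plane (0 1/2; 1/2 0) plus <c>. *)
Definition hyp_plus (F : fieldType) (c : F) : 'M[F]_3 :=
  block_mx (\matrix_(i < 2, j < 2) (if i == j then 0 else 2^-1)) 0
           0 (c%:M : 'M_1).

Definition locally_hyp (p : nat) (M : lattice 3) (c : Zadic p) :=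
  Zadic_equiv (gram_at p M) (hyp_plus (FracField.tofrac c : Qadic p)).

Definition calG (L : lattice 3) (p : nat) (eps : Zadic p) (m : nat) :
    set (lattice 3) :=
  [set T | [/\ integral T, locally_hyp T (eps * p%:R ^+ m) &
     forall q, prime q -> q != p -> isometric_at q T (scale (p%:R ^+ m) L)]].

(* Main.v *)
(* Put N_i = Gamma_{p,i}(T)^{1/p}, of local form x y + eps z^2 at p. Isotropic
   lines of N_i / p N_i are the p + 1 points of a conic, and two distinct points
   span a hyperbolic plane, i.e. a sublattice of index p of N_i that lies in
   gen(S). Three facts reduce the theorem to counting vectors.
   - The lattices of gen(S) with lambda_p = N_i are, up to isometry, these
     sublattices, and isometries from lambda_p(S') to N_i are p^-1 times the
     isometries from S' to one of them; hence o(N_i) sum r(., S') / o(S') is the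
     sum of r over all C(p+1, 2) planes.
   - The images of representations counted by r~(S'^p, T) are the 2p planes
     through the line of N_i / p N_i that is the image of p T, i = 1, 2.
   - A vector of N_i with norm divisible by p is in p N_i or on exactly one
     isotropic line, so the numbers of planes containing it are known.
   What remains is r(p^2 n, T) + r(n, T) = r(pn, N_1) + r(pn, N_2), which holds
   because x y + eps p z^2 = p^2 n forces p | x or p | y. *)

Require Import Defs.
From HB Require Import structures.
From mathcomp Require Import all_boot all_order all_algebra finmap.
From mathcomp Require Import boolp classical_sets functions cardinality fsbigop.
From mathcomp Require Import ring lra zify.
(* all_algebra has another [form]. *)
Require Import Defs.

Set Implicit Arguments.
Unset Strict Implicit.
Unset Printing Implicit Defensive.

Import Order.TTheory GRing.Theory Num.Theory.
Local Open Scope classical_set_scope.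
Local Open Scope ring_scope.

(** The prime 2 is allowed, and this shapes the local part. Modulo 2 the bilinear form of x y + eps
    z^2 has a radical, so a plane cannot be described as an orthogonal complement. It is the kernel
    of an explicit linear form, half of the pairing with [polar], and the adapted local bases only
    invert eps and the determinant of two distinct points. The number 2 is inverted only in Q_p, to
    pass from a quadratic form to its Gram matrix. A class sum is evaluated at chosen
    representatives. Its summand is therefore rewritten as a sum over a finite family of sublattices
    K, where K contributes if and only if the representative S' is isometric to K. The number of
    isometries from S' to K is o(S') or 0, so the weight 1 / o(S') turns a count of isometries into
    such an indicator, and each K is then met exactly once in the sum over the genus. *)

(** * Residues of p-adic integers *)

(* Like Zadic p, this needs no primality assumption on p. *)
Notation Fres p := ('F_(padic_prime p)).

Lemma Fres_intr_eq0 p (m : int) :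
  ((m%:~R : Fres p) == 0) = ((padic_prime p)%:Z %| m)%Z.
Proof.
have pp := padic_primeP p.
have natc k : ((k%:R : Fres p) == 0) = (padic_prime p %| k)%N.
  by rewrite -(dvdn_pcharf (pchar_Fp pp)).
case: m => k; first by rewrite -pmulrn natc dvdzE.
by rewrite NegzE mulrNz oppr_eq0 -pmulrn natc dvdzE abszN.
Qed.

Definition zres p (z : Zadic p) : Fres p := (z 1%N)%:~R.

Lemma zres_mod p (m : int) : ((m %% pmod p 1)%Z)%:~R = m%:~R :> Fres p.
Proof.
apply/eqP; rewrite -subr_eq0 -rmorphB /= Fres_intr_eq0.
by rewrite -[X in (X %| _)%Z]expr1 -eqz_mod_dvd modz_mod.
Qed.

Fact zres_is_zmod p : zmod_morphism (@zres p).
Proof.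
move=> x y; rewrite /zres /= zres_mod rmorphD /=; congr (_ + _).
by rewrite zres_mod rmorphN.
Qed.
HB.instance Definition _ p :=
  GRing.isZmodMorphism.Build (Zadic p) (Fres p) (@zres p) (@zres_is_zmod p).

Fact zres_is_monoid p : monoid_morphism (@zres p).
Proof.
split; first by rewrite /zres /= zres_mod.
by move=> x y; rewrite /zres /= zres_mod rmorphM.
Qed.
HB.instance Definition _ p :=
  GRing.isMonoidMorphism.Build (Zadic p) (Fres p) (@zres p) (@zres_is_monoid p).

Lemma zadic_intr p (m : int) k : (m%:~R : Zadic p) k = (m %% pmod p k)%Z.
Proof.
have natc j : (j%:R : Zadic p) k = (j%:Z %% pmod p k)%Z.
  elim: j => [|j IHj]; first by [].
  by rewrite -addn1 natrD /= IHj modzDml modzDmr -PoszD.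
case: m => j; first by rewrite -pmulrn natc.
by rewrite NegzE mulrNz -pmulrn /= natc modzNm.
Qed.

(** The power p^|m| exceeds |m|, so it does not divide m unless m = 0. *)
Lemma zadic_intr_inj p : injective (intr : int -> Zadic p).
Proof.
move=> m1 m2 /eqP; rewrite -subr_eq0 -rmorphB /= => /eqP m0.
apply/eqP; rewrite -subr_eq0; move: (m1 - m2) m0 => m m0.
have mk k : (pmod p k %| m)%Z.
  apply/dvdz_mod0P; rewrite -zadic_intr m0 /= mod0z //.
have := mk `|m|%N; rewrite dvdzE /pmod abszX absz_nat => dm.
apply: contraT => mN0; have {}dm := dvdn_leq _ dm.
have := dm; rewrite absz_gt0 mN0 => /(_ isT).
by rewrite leqNgt ltn_expl // prime_gt1 // padic_primeP.
Qed.

(** Division by p shifts the index: z_(k+1) = p y_k determines y_k modulo p^k. *)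
Lemma zres_eq0P p (z : Zadic p) :
  reflect (exists y, z = (padic_prime p)%:R * y) (zres z == 0).
Proof.
set q := padic_prime p; have pp : prime q := padic_primeP p.
have q0 : q%:Z != 0 by rewrite eqz_nat -lt0n prime_gt0.
apply: (iffP eqP) => [z0|[y ->]]; last first.
  rewrite rmorphM rmorph_nat /=.
  by have /eqP -> : (q%:R : Fres p) == 0; [rewrite -(dvdn_pcharf (pchar_Fp pp))|rewrite mul0r].
have qz k : (q%:Z %| z k.+1)%Z.
  have : (q%:Z %| z 1%N)%Z by rewrite -Fres_intr_eq0; exact/eqP.
  have e := zp_cohD z 1 k; rewrite add1n in e.
  rewrite /pmod expr1 in e.
  by move=> /dvdz_mod0P e1; apply/dvdz_mod0P; rewrite e.
have coh k : ((z k.+2 %/ q)%Z = (z k.+1 %/ q)%Z %[mod pmod p k])%Z.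
  apply/eqP; rewrite eqz_mod_dvd.
  have : (pmod p k.+1 %| z k.+2 - z k.+1)%Z by rewrite -eqz_mod_dvd zp_coh.
  rewrite -[X in (_ %| X - _)%Z -> _](divzK (qz k.+1)).
  rewrite -[X in (_ %| _ - X)%Z -> _](divzK (qz k)) -mulrBl /pmod exprSr.
  by rewrite dvdz_mul2r.
exists (mk coh); apply: zp_eq => k.
have -> : (q%:R * mk coh : Zadic p) k
   = ((q%:Z %% pmod p k)%Z * ((z k.+1 %/ q)%Z %% pmod p k)%Z %% pmod p k)%Z.
  by rewrite -(zadic_intr p q k).
by rewrite modzMml modzMmr modz_mod mulrC divzK // zp_coh.
Qed.

(** A nonzero residue makes every z_k prime to p, so Bezout inverts z modulo each p^k. The inverses
    chosen at different levels are coherent because an inverse modulo p^k is unique. *)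
Lemma zadic_unitE p (z : Zadic p) : (z \is a GRing.unit) = (zres z != 0).
Proof.
set q := padic_prime p; have pp : prime q := padic_primeP p.
apply/idP/idP => [zU|z0]; first by rewrite -unitfE rmorph_unit.
have qz k : coprimez (z k) (pmod p k).
  case: k => [|k]; first by rewrite /pmod expr0 coprimezE coprimen1.
  rewrite coprimezE /pmod abszX absz_nat coprimeXr // coprime_sym prime_coprime //.
  apply: contra z0; rewrite Fres_intr_eq0 -/q => qz.
  have e := zp_cohD z 1 k; rewrite add1n /pmod expr1 -/q in e.
  by apply/dvdz_mod0P; rewrite -e; apply/dvdz_mod0P; rewrite dvdzE.
have inv k : exists u, (u * z k = 1 %[mod pmod p k])%Z.
  have [u [v uv]] := Bezoutz (z k) (pmod p k); exists u.
  move: uv; rewrite (eqP (qz k)) => <-.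
  by rewrite addrC modzMDl.
pose f k := sval (cid (inv k)).
have fP k : (f k * z k = 1 %[mod pmod p k])%Z by rewrite /f; case: cid.
have coh k : (f k.+1 = f k %[mod pmod p k])%Z.
  have h1 : (f k.+1 * z k = 1 %[mod pmod p k])%Z.
    rewrite -modzMmr -zp_coh modzMmr; apply/eqP; rewrite eqz_mod_dvd.
    have : (pmod p k.+1 %| f k.+1 * z k.+1 - 1)%Z by rewrite -eqz_mod_dvd fP.
    by apply: dvdz_trans; rewrite /pmod exprS dvdz_mull.
  rewrite -[f k.+1]mulr1 -modzMmr -(fP k) modzMmr mulrCA -modzMmr h1 modzMmr.
  by rewrite mulr1.
apply/unitrP; exists (mk coh).
have e : mk coh * z = 1.
  by apply: zp_eq => k /=; rewrite !modz_mod modzMml fP.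
by split => //; rewrite mulrC.
Qed.

(** * Lattices, isometries and class sums *)

Notation cnt A := (#|` fset_set A|).

Section Counting.
Variables (T : choiceType).
Implicit Types A D : set T.

Lemma fset_setP A x : finite_set A -> reflect (A x) (x \in fset_set A).
Proof. by move=> fA; rewrite in_fset_set //; apply: (iffP idP) => [/set_mem|/mem_set]. Qed.

(** Turns cardinals into sums over a common finite set, so that double counting becomes
    [exchange_big]. *)
Lemma cntE D A : finite_set D -> A `<=` D ->
  cnt A = (\sum_(x <- fset_set D) `[< A x >])%N.
Proof.
move=> fD AD; have fA := sub_finite_set AD fD.
rewrite card_fset_sum1 -[RHS](@big_fset_incl _ _ _ _ (fset_set A)).
- by apply: eq_big_seq => x /(fset_setP x fA) Ax; rewrite asboolT.
- by rewrite -fset_set_sub.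
- by move=> x _ /negP xA; rewrite asboolF // => Ax; apply/xA/fset_setP.
Qed.

Lemma cnt_gt0 A : finite_set A -> A !=set0 -> (0 < cnt A)%N.
Proof.
move=> fA [x xA]; rewrite cardfs_gt0; apply/fset0Pn; exists x.
by rewrite in_fset_set // inE.
Qed.

Lemma cnt_image (U : choiceType) (f : T -> U) A : finite_set A ->
  (forall x y, A x -> A y -> f x = f y -> x = y) -> cnt (f @` A) = cnt A.
Proof.
move=> fA finj; rewrite fset_set_image //.
rewrite card_in_imfset //= => x y.
by rewrite !in_fset_set // !inE; exact: finj.
Qed.

Lemma cnt_bigU (I : finType) (P : pred I) (E : I -> set T) A :
  (forall i, P i -> finite_set (E i)) ->
  (forall x, A x <-> exists2 i, P i & E i x) ->
  (forall i j x, P i -> P j -> E i x -> E j x -> i = j) ->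
  cnt A = (\sum_(i | P i) cnt (E i))%N.
Proof.
move=> fE AE dE.
have fA : finite_set A.
  apply: (@sub_finite_set _ _ (\bigcup_(i in [set i | P i]) E i)).
    by move=> x /AE[i Pi Ei]; exists i.
  by apply: bigcup_finite => [|i]; [exact: finite_finset|exact: fE].
have EA i : P i -> E i `<=` A by move=> Pi x Ex; apply/AE; exists i.
rewrite (cntE fA (@subset_refl _ A)).
under [RHS]eq_bigr => i Pi do rewrite (cntE fA (EA i Pi)).
rewrite exchange_big /=; apply: eq_big_seq => x.
rewrite in_fset_set // inE => xA.
have [i Pi Ei] := (AE x).1 xA.
rewrite (asboolT xA) (bigD1 i) //= (asboolT Ei) big1 // => j /andP[Pj ji].
apply/eqP; rewrite eqb0; apply/asboolPn => Ej.
by rewrite (dE i j x Pi Pj Ei Ej) eqxx in ji.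
Qed.

End Counting.

Section Lattice.
Variable n : nat.
Implicit Types (M N K : lattice n) (x y z : 'rV[rat]_n).

(** On the carrier the coordinates are already integers, and [numq] only changes their type. *)
Definition zc M x : 'rV[int]_n := map_mx numq (x *m invmx (basis M)).

Lemma zcE M v : zc M (map_mx intr v *m basis M) = v.
Proof.
rewrite /zc mulmxK ?basis_unit //; apply/matrixP => i j.
by rewrite !mxE numq_int.
Qed.

Lemma zcK M x : carrier M x -> map_mx intr (zc M x) *m basis M = x.
Proof. by case=> v _ <-; rewrite zcE. Qed.

Lemma carrier_intr M (v : 'rV[int]_n) : carrier M (map_mx intr v *m basis M).
Proof. by exists v. Qed.

Lemma carrier0 M : carrier M 0.
Proof. by exists 0; rewrite // map_mx0 mul0mx. Qed.

Lemma carrierD M x y : carrier M x -> carrier M y -> carrier M (x + y).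
Proof. by move=> [u _ <-] [v _ <-]; exists (u + v); rewrite // map_mxD mulmxDl. Qed.

Lemma carrierN M x : carrier M x -> carrier M (- x).
Proof. by move=> [u _ <-]; exists (- u); rewrite // map_mxN mulNmx. Qed.

Lemma carrierB M x y : carrier M x -> carrier M y -> carrier M (x - y).
Proof. by move=> Mx /carrierN; exact: carrierD. Qed.

Lemma carrier_nat M (k : nat) x : carrier M x -> carrier M (k%:R *: x).
Proof.
move=> Mx; rewrite scaler_nat.
by elim: k => [|k IHk]; rewrite ?mulrS; [exact: carrier0|exact: carrierD].
Qed.

Lemma zcD M x y : carrier M x -> carrier M y -> zc M (x + y) = zc M x + zc M y.
Proof. by move=> [u _ <-] [v _ <-]; rewrite -mulmxDl -map_mxD !zcE. Qed.

Lemma B_form M N : form M = form N -> B M = B N.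
Proof. by rewrite /B => ->. Qed.

Lemma Q_form M N : form M = form N -> Q M = Q N.
Proof. by rewrite /Q => /B_form ->. Qed.

Lemma B_formZ M N a x y : form M = a *: form N -> B M x y = a * B N x y.
Proof. by rewrite /B => ->; rewrite -scalemxAr -scalemxAl mxE. Qed.

Lemma BDl M x y z : B M (x + y) z = B M x z + B M y z.
Proof. by rewrite /B !mulmxDl mxE. Qed.

Lemma BDr M x y z : B M z (x + y) = B M z x + B M z y.
Proof. by rewrite /B linearD /= mulmxDr mxE. Qed.

Lemma BZl M a x z : B M (a *: x) z = a * B M x z.
Proof. by rewrite /B -!scalemxAl mxE. Qed.

Lemma BZr M a x z : B M z (a *: x) = a * B M z x.
Proof. by rewrite /B linearZ /= -scalemxAr mxE. Qed.

Lemma BC M x y : B M x y = B M y x.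
Proof.
rewrite /B -[in LHS](trmxK (x *m _ *m _)) mxE trmx_mul trmxK trmx_mul form_sym.
by rewrite mulmxA.
Qed.

Lemma QD M x y : Q M (x + y) = Q M x + Q M y + 2 * B M x y.
Proof. by rewrite /Q BDl !BDr (BC M y x); ring. Qed.

Lemma QZ M a x : Q M (a *: x) = a ^+ 2 * Q M x.
Proof. by rewrite /Q BZl BZr mulrA expr2. Qed.

Lemma Q_gt0 M x : x != 0 -> 0 < Q M x.
Proof. exact: form_pos. Qed.

Lemma Q_ge0 M x : 0 <= Q M x.
Proof.
by have [->|/(Q_gt0 M)/ltW//] := eqVneq x 0; rewrite /Q /B !mul0mx mxE.
Qed.

Lemma form_unit M : form M \in unitmx.
Proof.
rewrite -row_free_unit; apply/row_freeP; apply: contrapT => nfree.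
have : ~~ row_free (form M) by apply/negP => /row_freeP.
rewrite -kermx_eq0 => /rowV0Pn [x /sub_kermxP xM x0].
by have := form_pos M x0; rewrite xM mul0mx mxE ltxx.
Qed.

Lemma B_ext M (G : 'M[rat]_n) :
  (forall x y, (x *m G *m y^T) 0 0 = B M x y) -> G = form M.
Proof.
move=> GE; apply/matrixP => i j.
have := GE (delta_mx 0 i) (delta_mx 0 j).
by rewrite /B -!rowE trmx_delta -!colE !mxE.
Qed.

Lemma preserves_formP M N X :
  preserves_form M N X <-> X *m form N *m X^T = form M.
Proof.
split => [h|h x y].
  by apply: B_ext => x y; rewrite -h /B trmx_mul !mulmxA.
by rewrite /B -h trmx_mul !mulmxA.
Qed.

Lemma preserves_form_unit M N X : preserves_form M N X -> X \in unitmx.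
Proof.
move=> /preserves_formP h; have := form_unit M.
by rewrite -h !unitmx_mul -andbA => /andP[].
Qed.

Lemma isometries_id M : isometries M M 1%:M.
Proof.
split=> [x y|]; first by rewrite !mulmx1.
apply/seteqP; split=> x; first by case=> y My <-; rewrite mulmx1.
by exists x; rewrite ?mulmx1.
Qed.

Lemma isometries_comp M N K X Y :
  isometries M N X -> isometries N K Y -> isometries M K (X *m Y).
Proof.
move=> [Xf Xc] [Yf Yc]; split=> [x y|]; first by rewrite !mulmxA Yf Xf.
apply/seteqP; split=> x.
  case=> y My <-; have NyX : carrier N (y *m X) by rewrite -Xc; exists y.
  by rewrite mulmxA -Yc; exists (y *m X).
rewrite -{1}Yc => -[y Ny <-]; move: Ny; rewrite -{1}Xc => -[z Mz <-].
by exists z; rewrite // mulmxA.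
Qed.

Lemma isometries_inv M N X : isometries M N X -> isometries N M (invmx X).
Proof.
move=> [Xf Xc]; have Xu := preserves_form_unit Xf; split=> [x y|].
  by rewrite -Xf !mulmxKV.
apply/seteqP; split=> x.
  by case=> y; rewrite -Xc => -[z Mz <-] <-; rewrite mulmxK.
move=> Mx; have NxX : carrier N (x *m X) by rewrite -Xc; exists x.
by exists (x *m X); rewrite ?mulmxK.
Qed.

Lemma isometries_eq K M N : form M = form N -> carrier M = carrier N ->
  isometries K M = isometries K N.
Proof.
move=> fMN cMN; have BMN := B_form fMN.
apply/seteqP; split=> X [Xf Xc]; split; rewrite ?Xc // => x y.
  by rewrite -BMN Xf.
by rewrite BMN Xf.
Qed.

Lemma isometric_refl M : isometric M M.
Proof. by exists 1%:M; exact: isometries_id. Qed.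

Lemma isometric_sym M N : isometric M N -> isometric N M.
Proof. by case=> X /isometries_inv; exists (invmx X). Qed.

Lemma isometric_trans M N K : isometric M N -> isometric N K -> isometric M K.
Proof.
by case=> X XP [Y YP]; exists (X *m Y); exact: isometries_comp XP YP.
Qed.

Lemma iso_classE M N : isometric M N <-> iso_class M = iso_class N.
Proof.
split=> [MN|e]; last first.
  have : iso_class N N by exact: isometric_refl.
  by rewrite -e.
apply/seteqP; split=> K /= h; apply: isometric_trans h => //.
exact: isometric_sym.
Qed.

Lemma isometries_carrier M N X x : isometries M N X ->
  carrier M x -> carrier N (x *m X).
Proof. by case=> _ <- Mx; exists x. Qed.

Lemma isometries_Q M N X x : isometries M N X -> Q N (x *m X) = Q M x.
Proof. by case=> Xf _; exact: Xf. Qed.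

Lemma isometries_preimage M N X y : isometries M N X -> carrier N y ->
  exists2 x, carrier M x & y = x *m X.
Proof. by case=> _ <- [x Mx <-]; exists x. Qed.

Lemma cauchy_schwarz M x y : B M x y ^+ 2 <= Q M x * Q M y.
Proof.
have [->|y0] := eqVneq y 0.
  by rewrite /Q /B !trmx0 !mulmx0 !mxE expr0n /= mulr0.
have Qy := Q_gt0 M y0.
have := Q_ge0 M (Q M y *: x - B M x y *: y).
rewrite -scaleNr QD !QZ BZl BZr.
have -> : Q M y ^+ 2 * Q M x + (- B M x y) ^+ 2 * Q M y
  + 2 * (Q M y * (- B M x y * B M x y))
  = Q M y * (Q M x * Q M y - B M x y ^+ 2) by ring.
by rewrite pmulr_rge0 // subr_ge0.
Qed.

Lemma finite_bounded_mx m (C : nat) :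
  finite_set [set W : 'M[int]_(m, n) | forall i j, (`|W i j| <= C)%N].
Proof.
pose f (W : 'M['I_(C + C).+1]_(m, n)) : 'M[int]_(m, n) :=
  map_mx (fun i : 'I__ => i%:Z - C%:Z) W.
apply: (@sub_finite_set _ _ (f @` [set: _])); last first.
  by apply: finite_image; exact: finite_finset.
move=> W /= WC.
exists (map_mx (fun z : int => inord (absz (z + C%:Z))) W) => //.
apply/matrixP => i j; rewrite !mxE; have := WC i j; move: (W i j) => z zC.
by rewrite inordK; lia.
Qed.

(** The basis dual to [basis M] under B. By Cauchy-Schwarz, pairing with it bounds the coordinates
    of the vectors of a given norm, and the finiteness of all counted sets follows. *)
Definition dual M i : 'rV[rat]_n := row i (invmx (basis M))^T *m invmx (form M).

Lemma zc_dual M x i : carrier M x -> (zc M x 0 i)%:~R = B M x (dual M i).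
Proof.
move=> [v _ <-]; rewrite zcE /B /dual trmx_mul mulmxA.
rewrite (trmx_inv (form M)) form_sym mulmxK ?form_unit // tr_row trmxK.
by rewrite colE mulmxA mulmxK ?basis_unit // -colE !mxE.
Qed.

Lemma zc_bound M x i : carrier M x ->
  ((zc M x 0 i)%:~R ^+ 2 <= Q M x * Q M (dual M i)).
Proof. by move=> /zc_dual ->; exact: cauchy_schwarz. Qed.

Lemma absz_bound (z : int) (b : rat) : z%:~R ^+ 2 <= b -> (`|z| <= Num.bound b)%N.
Proof.
move=> zb; have b0 : 0 <= b by apply: le_trans zb; exact: sqr_ge0.
have := le_lt_trans zb (archi_boundP b0).
rewrite -rmorphXn /= -[X in _ < X]/((Num.bound b)%:Z%:~R) ltr_int => zB.
by rewrite -lez_nat abszE; nia.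
Qed.

Lemma finite_sphere M (b : rat) : finite_set [set x | carrier M x /\ Q M x = b].
Proof.
pose C := (\max_i Num.bound (b * Q M (dual M i)))%N.
apply: (@sub_finite_set _ _
  ((fun W : 'rV[int]_n => map_mx intr W *m basis M)
     @` [set W : 'M[int]_(1, n) | forall i j, (`|W i j| <= C)%N])).
  move=> x /= [Mx Qx]; exists (zc M x); last exact: zcK.
  move=> i j; rewrite (ord1 i); have := zc_bound j Mx; rewrite Qx => /absz_bound.
  by move=> h; apply: leq_trans h _; rewrite /C (bigD1 j) //= leq_maxl.
by apply: finite_image; exact: finite_bounded_mx.
Qed.

Lemma row_basis_carrier M i : carrier M (row i (basis M)).
Proof.
exists (delta_mx 0 i) => //.
by rewrite rowE; congr (_ *m _); apply/matrixP => k l; rewrite !mxE; case: (_ && _).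
Qed.

(** A representation is determined by the images of the basis of M, whose norms are prescribed. *)
Lemma finite_representations M N : finite_set (representations M N).
Proof.
pose C := (\max_i \max_j Num.bound (Q M (row i (basis M)) * Q N (dual N j)))%N.
apply: (@sub_finite_set _ _
  ((fun W : 'M[int]_n => invmx (basis M) *m (map_mx intr W *m basis N))
     @` [set W : 'M[int]_(n, n) | forall i j, (`|W i j| <= C)%N])).
  move=> X [Xf Xc].
  have Nc i : carrier N (row i (basis M) *m X).
    by apply: Xc; exists (row i (basis M)) => //; exact: row_basis_carrier.
  exists (\matrix_i zc N (row i (basis M) *m X)); last first.
    apply: (canLR (mulKmx (basis_unit M))); apply/row_matrixP => i.
    rewrite !row_mul; rewrite -[RHS](zcK (Nc i)); congr (_ *m _).
    by apply/rowP => j; rewrite !mxE.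
  move=> i j; rewrite mxE.
  have := zc_bound j (Nc i); rewrite {1}/Q Xf => /absz_bound.
  move=> h; apply: leq_trans h _; rewrite /C (bigD1 i) //= (bigD1 j) //=.
  by apply: leq_trans (leq_maxl _ _); exact: leq_maxl.
by apply: finite_image; exact: finite_bounded_mx.
Qed.

Lemma isometries_sub M N : isometries M N `<=` representations M N.
Proof. by move=> X [Xf Xc]; split; rewrite // Xc. Qed.

Lemma finite_isometries M N : finite_set (isometries M N).
Proof. exact: sub_finite_set (@isometries_sub M N) (finite_representations M N). Qed.

Lemma o_gt0 M : (0 < o M)%N.
Proof.
by apply: cnt_gt0; [exact: finite_isometries|exists 1%:M; exact: isometries_id].
Qed.

Lemma cnt_isometries M N X : isometries M N X -> cnt (isometries M N) = o M.
Proof.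
move=> MNX; have Xu := preserves_form_unit MNX.1.
rewrite /o -(@cnt_image _ _ (mulmxr X) (isometries M M)).
- congr (cnt _); apply/seteqP; split=> [Y MNY|_ [Y MMY <-]]; last first.
    exact: isometries_comp MMY MNX.
  exists (Y *m invmx X) => /=; last by rewrite mulmxKV.
  exact: isometries_comp MNY (isometries_inv MNX).
- exact: finite_isometries.
- by move=> Y Z _ _ /= /(congr1 (mulmxr (invmx X))) /=; rewrite !mulmxK.
Qed.

Lemma cnt_isometriesE M N :
  cnt (isometries M N) = (if `[< isometric M N >] then o M else 0)%N.
Proof.
case: asboolP => [[X /cnt_isometries //]|h].
suff -> : isometries M N = set0 by rewrite fset_set0 cardfs0.
by apply/seteqP; split=> // X MX; case: h; exists X.
Qed.

(** The set [isometries M N] is a torsor under both isometry groups; [cnt_isometries] used that of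
    M, and this proof uses that of N. *)
Lemma o_isometric M N : isometric M N -> o M = o N.
Proof.
case=> X MNX; rewrite -(cnt_isometries MNX) /o.
have Xu := preserves_form_unit MNX.1.
rewrite -(@cnt_image _ _ (mulmx X) (isometries N N)).
- congr (cnt _); apply/seteqP; split=> [Y MNY|_ [Y NNY <-]]; last first.
    exact: isometries_comp MNX NNY.
  exists (invmx X *m Y) => /=; last by rewrite mulKVmx.
  exact: isometries_comp (isometries_inv MNX) MNY.
- exact: finite_isometries.
- by move=> Y Z _ _ /= /(congr1 (mulmx (invmx X))) /=; rewrite !mulKmx.
Qed.

Lemma r_isometric k M N : isometric M N -> r k M = r k N.
Proof.
case=> X MNX; have Xu := preserves_form_unit MNX.1.
rewrite /r -(@cnt_image _ _ (mulmxr X) [set x | carrier M x /\ _]).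
- congr (cnt _); apply/seteqP; split=> y /=.
    move=> [x [Mx Qx] <-]; split; first exact: isometries_carrier MNX Mx.
    by rewrite (isometries_Q _ MNX).
  move=> [/(isometries_preimage MNX)[x Mx ->]].
  by rewrite (isometries_Q _ MNX) => Qx; exists x.
- exact: finite_sphere.
- by move=> Y Z _ _ /= /(congr1 (mulmxr (invmx X))) /=; rewrite !mulmxK.
Qed.

(** The hypothesis on F shows only isometry classes, so the representative picked by [xget] is
    irrelevant. Each index i contributes to exactly one class, that of [K i], and this class meets
    A. *)
Lemma class_sumE (S0 : lattice n) (A : set (lattice n)) (I : finType)
    (P : pred I) (K : I -> lattice n) (F G : lattice n -> rat) :
  (forall i, P i -> A (K i)) ->
  (forall S', A S' ->
    F S' = \sum_(i | P i) (if `[< isometric S' (K i) >] then G (K i) else 0)) ->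
  class_sum S0 A F = \sum_(i | P i) G (K i).
Proof.
move=> AK FE; rewrite /class_sum.
pose D := [set iso_class (K i) | i in [set i | P i]].
have fD : finite_set D by apply: finite_image; exact: finite_finset.
have FE' c : [set iso_class M | M in A] c -> F (xget S0 (A `&` c))
    = \sum_(i | P i) (if c == iso_class (K i) then G (K i) else 0).
  move=> [M AM <-].
  have : exists N, (A `&` iso_class M) N.
    by exists M; split => //; exact: isometric_refl.
  move=> /(@xgetPex _ S0); set N := xget _ _ => -[AN MN].
  rewrite FE //; apply: eq_bigr => i _; congr (if _ then _ else _).
  have -> : iso_class M = iso_class N by apply/iso_classE.
  by apply/asboolP/eqP => /iso_classE.
rewrite (eq_fsbigr _ _ (fun c cA => FE' c (set_mem cA))).
(* Restriction to the finite set of the classes of the [K i]; every other class contributes 0. *)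
rewrite -(@fsbig_widen _ _ _ _ D); last 2 first.
- by move=> _ [i Pi <-]; exists (K i) => //; exact: AK.
- move=> c [_ Dc] /=; rewrite big1 // => i Pi; case: eqP => // ci.
  by case: Dc; exists i.
rewrite fsbig_finite // exchange_big /=; apply: eq_bigr => i Pi.
have iD : iso_class (K i) \in fset_set D.
  by rewrite in_fset_set // inE; exists i.
rewrite (big_fsetD1 _ iD) /= eqxx big1_fset ?addr0 // => c.
by rewrite !inE => /andP[/negbTE ->].
Qed.

End Lattice.

(** * Completions and sublattices *)

Lemma qadic_intr p (m : int) :
  @FracField.tofrac (Zadic p) m%:~R = m%:~R.
Proof. by rewrite rmorph_int. Qed.

Lemma qadic_intr_eq0 p (m : int) : (m%:~R == 0 :> Qadic p) = (m == 0).
Proof.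
rewrite -qadic_intr tofrac_eq0; apply/eqP/eqP => [|->]; last by rewrite mulr0z.
exact: (@zadic_intr_inj p m 0).
Qed.

Lemma qadic_nat_neq0 p k : (0 < k)%N -> k%:R != 0 :> Qadic p.
Proof. by move=> k0; rewrite (qadic_intr_eq0 p k) eqz_nat -lt0n. Qed.

Lemma zadic_nat_neq0 p k : (0 < k)%N -> k%:R != 0 :> Zadic p.
Proof. by move=> k0; rewrite -tofrac_eq0 rmorph_nat qadic_nat_neq0. Qed.

(* [ratr] is only known to be a morphism into a numFieldType. *)
Definition qemb p : rat -> Qadic p := ratr.

Lemma qembE p (x : rat) (a b : int) : b != 0 -> x * b%:~R = a%:~R ->
  qemb p x = a%:~R / b%:~R.
Proof.
move=> b0 xb; have d0 := denq_neq0 x.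
have e : numq x * b = a * denq x.
  apply: (@intr_inj rat); rewrite !rmorphM /= -xb numqE; ring.
apply/eqP; rewrite /qemb /ratr eqr_div ?qadic_intr_eq0 // -!rmorphM /=.
by rewrite e.
Qed.

Fact qemb_is_zmod p : zmod_morphism (@qemb p).
Proof.
move=> x y; rewrite (@qembE p (x - y) (numq x * denq y - numq y * denq x)
  (denq x * denq y)) ?mulf_neq0 ?denq_neq0 //; last first.
  by rewrite !(rmorphM, rmorphB) /= !numqE; ring.
rewrite /qemb /ratr !(rmorphM, rmorphB) /=.
by rewrite -[X in _ = _ + X]mulNr addf_div ?qadic_intr_eq0 ?denq_neq0 // mulNr.
Qed.
HB.instance Definition _ p :=
  GRing.isZmodMorphism.Build rat (Qadic p) (@qemb p) (@qemb_is_zmod p).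

Fact qemb_is_monoid p : monoid_morphism (@qemb p).
Proof.
split; first by rewrite (@qembE p 1 1 1) // divr1.
move=> x y; rewrite (@qembE p (x * y) (numq x * numq y) (denq x * denq y))
  ?mulf_neq0 ?denq_neq0 //; last by rewrite !rmorphM /= !numqE; ring.
rewrite /qemb /ratr !rmorphM /=.
by rewrite mulf_div.
Qed.
HB.instance Definition _ p :=
  GRing.isMonoidMorphism.Build rat (Qadic p) (@qemb p) (@qemb_is_monoid p).

Notation tf := (@FracField.tofrac (Zadic _)).

Lemma gram_atE q n (M : lattice n) : gram_at q M =
  map_mx (@qemb q) (basis M *m form M *m (basis M)^T).
Proof. by []. Qed.

Lemma tf_intr_mx p m n (A : 'M[int]_(m, n)) :
  map_mx tf (map_mx (intr : int -> Zadic p) A) = map_mx (@qemb p) (map_mx intr A).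
Proof. by apply/matrixP => i j; rewrite !mxE /= !rmorph_int. Qed.

Lemma zres_intr_mx p m n (A : 'M[int]_(m, n)) :
  map_mx (@zres p) (map_mx intr A) = map_mx intr A.
Proof. by apply/matrixP => i j; rewrite !mxE /= rmorph_int. Qed.

Lemma rmorph_unitmx (R S : comUnitRingType) (f : {rmorphism R -> S}) n (A : 'M[R]_n) :
  A \in unitmx -> map_mx f A \in unitmx.
Proof. by rewrite !unitmxE det_map_mx => /rmorph_unit ->. Qed.

Lemma tf_mx_inj p m n : injective (fun A : 'M[Zadic p]_(m, n) => map_mx tf A).
Proof.
move=> A A' /matrixP AA'; apply/matrixP => i j; have := AA' i j.
by rewrite !mxE => /eqP; rewrite tofrac_eq => /eqP.
Qed.

Section Equiv.
Variables (q n : nat).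
Implicit Types A C : 'M[Qadic q]_n.

Lemma Zadic_equiv_trans A A' C :
  Zadic_equiv A A' -> Zadic_equiv A' C -> Zadic_equiv A C.
Proof.
move=> [U Uu <-] [V Vu <-]; exists (V *m U); first by rewrite unitmx_mul Vu.
by rewrite map_mxM trmx_mul !mulmxA.
Qed.

Lemma Zadic_equiv_sym A A' : Zadic_equiv A A' -> Zadic_equiv A' A.
Proof.
move=> [U Uu <-]; exists (invmx U); first by rewrite unitmx_inv.
rewrite !mulmxA -map_mxM mulVmx // map_mx1 mul1mx.
by rewrite -mulmxA -trmx_mul -map_mxM mulVmx // map_mx1 trmx1 mulmx1.
Qed.

Lemma Zadic_equivZ a A A' : Zadic_equiv A A' -> Zadic_equiv (a *: A) (a *: A').
Proof.
by move=> [U Uu <-]; exists U; rewrite // -scalemxAr -scalemxAl.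
Qed.

Lemma Zadic_equiv_sqr (k : Zadic q) A : k \is a GRing.unit ->
  Zadic_equiv A (tf k ^+ 2 *: A).
Proof.
move=> ku; exists k%:M.
  by rewrite unitmxE det_scalar unitrX.
rewrite map_scalar_mx mul_scalar_mx tr_scalar_mx mul_mx_scalar scalerA.
by rewrite -expr2.
Qed.

Lemma gram_at_formZ a (M N : lattice n) :
  form N = a *: form M -> basis N = basis M ->
  gram_at q N = qemb q a *: gram_at q M.
Proof. by move=> fN bN; rewrite !gram_atE fN bN -scalemxAr -scalemxAl map_mxZ. Qed.

End Equiv.

Lemma scaleE n (a : rat) (M : lattice n) : 0 < a -> form (scale a M) = a *: form M.
Proof. by move=> a0; rewrite /= /scale_coef a0. Qed.

Lemma gram_at_scale q n a (M : lattice n) : 0 < a ->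
  gram_at q (scale a M) = qemb q a *: gram_at q M.
Proof. by move=> a0; apply: gram_at_formZ => //; exact: scaleE. Qed.

Lemma natr_unit_zadic p q : prime p -> prime q -> q != p ->
  (p%:R : Zadic q) \is a GRing.unit.
Proof.
move=> pp qp qNp; rewrite zadic_unitE rmorph_nat (Fres_intr_eq0 q p).
by rewrite dvdzE /= padic_primeE // dvdn_prime2.
Qed.

Section Sublattice.
Variable n : nat.
Implicit Types M K : lattice n.

Lemma sublattice_basis M K : carrier K `<=` carrier M ->
  exists H : 'M[int]_n, basis K = map_mx intr H *m basis M.
Proof.
move=> KM; have Mr i := KM _ (row_basis_carrier K i).
exists (\matrix_i zc M (row i (basis K))).
apply/row_matrixP => i; rewrite row_mul -[LHS](zcK (Mr i)); congr (_ *m _).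
by apply/rowP => j; rewrite !mxE.
Qed.

(** P is the matrix of multiplication by k from M to K. It makes H invertible wherever k is a
    unit. *)
Lemma sublattice_cobasis (k : nat) M K (H : 'M[int]_n) :
  basis K = map_mx intr H *m basis M ->
  (forall x, carrier M x -> carrier K (k%:R *: x)) ->
  exists P : 'M[int]_n, P *m H = k%:Z%:M.
Proof.
move=> KH kK; have Kr i := kK _ (row_basis_carrier M i).
exists (\matrix_i zc K (k%:R *: row i (basis M))).
suff e : map_mx intr (\matrix_i zc K (k%:R *: row i (basis M)) *m H) *m basis M
     = map_mx (intr : int -> rat) k%:Z%:M *m basis M.
  apply/matrixP => i j; have /matrixP/(_ i j) := can_inj (mulmxK (basis_unit M)) e.
  by rewrite mxE [RHS]mxE => /intr_inj.
rewrite map_mxM -mulmxA -KH map_scalar_mx mul_scalar_mx.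
apply/row_matrixP => i; rewrite row_mul linearZ /= -[RHS](zcK (Kr i)); congr (_ *m _).
by apply/rowP => j; rewrite !mxE.
Qed.

Lemma gram_at_sub q a M K (H : 'M[int]_n) :
  form K = a *: form M -> basis K = map_mx intr H *m basis M ->
  gram_at q K = qemb q a *:
    (map_mx tf (map_mx intr H) *m gram_at q M *m (map_mx tf (map_mx intr H))^T).
Proof.
move=> fK KH; rewrite !tf_intr_mx !gram_atE map_trmx -!map_mxM -map_mxZ fK KH.
by rewrite trmx_mul -scalemxAr -scalemxAl !mulmxA.
Qed.

(** From P H = p the determinant of H divides a power of p, a unit of Z_q, so K and M have the same
    completion at q up to the factor a of the form. *)
Lemma sublattice_at (p q : nat) a M K : prime p -> prime q -> q != p ->
  form K = a *: form M -> carrier K `<=` carrier M ->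
  (forall x, carrier M x -> carrier K (p%:R *: x)) ->
  Zadic_equiv (gram_at q K) (qemb q a *: gram_at q M).
Proof.
move=> pp qp qNp fK KM pK.
have [H KH] := sublattice_basis KM; have [P PH] := sublattice_cobasis KH pK.
apply: Zadic_equiv_sym; exists (map_mx intr H).
  have := congr1 (fun A => \det (map_mx (intr : int -> Zadic q) A)) PH.
  rewrite map_mxM det_mulmx map_scalar_mx det_scalar /= => e.
  have : p%:R ^+ n \is a @GRing.unit (Zadic q) by rewrite unitrX // natr_unit_zadic.
  by rewrite -[p%:R]/(p%:~R) -e unitrM -!unitmxE => /andP[].
by rewrite (gram_at_sub q fK KH) !tf_intr_mx -scalemxAr -scalemxAl.
Qed.

(** Sublattices given by congruences need an explicit basis. Lift h to an integral H with Smith form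
    L D R. As R is invertible modulo p, a vector v satisfies v H = 0 modulo p if and only if p
    divides (v L)_i for each i at which D has a diagonal entry prime to p. These are exactly the
    indices where [del] is p, so diag([del]) L^-1 is a basis. *)
Lemma ker_lattice p k M (h : 'M[Fres p]_(n, k)) :
  exists2 K, form K = form M &
    forall x, carrier K x <-> carrier M x /\ map_mx intr (zc M x) *m h = 0.
Proof.
set ell := padic_prime p.
pose H := map_mx (fun z : Fres p => (z : nat)%:Z) h.
have hH : h = map_mx intr H by apply/matrixP => i j; rewrite !mxE -pmulrn natr_Zp.
have [L Lu [R Ru [d _ HE]]] := int_Smith_normal_form H.
pose del (i : 'I_n) : int := if (i < k)%N && ~~ (ell %| d`_i)%Z then ell%:Z else 1.
pose D : 'rV[int]_n := \row_i del i.
have del0 i : del i != 0.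
  by rewrite /del; case: ifP => // _; rewrite eqz_nat -lt0n prime_gt0 ?padic_primeP.
have bu : map_mx intr (diag_mx D *m invmx L) *m basis M \in unitmx.
  rewrite unitmx_mul basis_unit andbT map_mxM unitmx_mul.
  rewrite (rmorph_unitmx _ (_ : invmx L \in unitmx)) ?unitmx_inv // andbT.
  rewrite unitmxE det_map_mx det_diag unitfE intr_eq0; apply/prodf_neq0 => i _.
  by rewrite mxE del0.
exists (MkLattice (form_sym M) (@form_pos _ M) bu) => //.
have key (v : 'rV[int]_n) : map_mx intr v *m h = 0 <-> exists u, v = u *m (diag_mx D *m invmx L).
  have -> : (map_mx intr v *m h = 0) <-> forall i, (v *m L) 0 i \in dvdz (del i).
    rewrite hH HE -map_mxM !mulmxA map_mxM.
    have RFu : map_mx intr R \in unitmx by move=> S; exact: rmorph_unitmx.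
    set w := v *m L.
    have -> : (map_mx intr (w *m \matrix_(i, j) (d`_i *+ (i == j :> nat))) *m map_mx intr R = 0 :> 'M[Fres p]__)
      <-> (map_mx intr (w *m \matrix_(i, j) (d`_i *+ (i == j :> nat))) = 0 :> 'M[Fres p]_(1, k)).
      split=> [e|->]; last by rewrite mul0mx.
      by apply: (can_inj (mulmxK (RFu _))); rewrite mul0mx.
    split=> [e i|wd].
      rewrite /del; case: ifP => [/andP[ik di]|_]; last exact: dvd1z.
      have /matrixP/(_ 0 (Ordinal ik)) := e.
      rewrite [RHS]mxE mxE mxE (bigD1 i) //= mxE eqxx mulr1n big1 ?addr0; last first.
        by move=> j ji; rewrite mxE /= (inj_eq val_inj) (negbTE ji) mulr0n mulr0.
      move=> /eqP; rewrite rmorphM mulf_eq0 /= !Fres_intr_eq0 -/ell.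
      by rewrite (negbTE di) orbF.
    apply/matrixP => z j; rewrite (ord1 z) !mxE rmorph_sum big1 //= => i _.
    rewrite mxE; case: eqP => [ij|_]; last by rewrite mulr0n mulr0.
    have := wd i; rewrite /del; case: ifP => [_ wi|].
      by apply/eqP; rewrite mulr1n rmorphM mulf_eq0 /= !Fres_intr_eq0 -/ell wi.
    rewrite ij ltn_ord /= => /negbFE di _.
    by apply/eqP; rewrite mulr1n rmorphM mulf_eq0 /= !Fres_intr_eq0 -/ell di orbT.
  split=> [wd|[u ->] i].
    exists (\row_i divz ((v *m L) 0 i) (del i)).
    apply: (can_inj (mulmxK Lu)); rewrite !mulmxA mulmxKV //.
    apply/rowP => i; rewrite mul_mx_diag !mxE divzK //.
    by have := wd i; rewrite mxE.
  by rewrite !mulmxA mulmxKV // mul_mx_diag !mxE dvdz_mull.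
move=> x; split.
  move=> [u _ <-]; rewrite /= mulmxA -map_mxM zcE; split; first exact: carrier_intr.
  by apply/key; exists u.
move=> [Mx /key [u uE]]; exists u => //=.
by rewrite mulmxA -map_mxM -uE zcK.
Qed.

End Sublattice.

(** * The conic x y + c z^2 = 0 *)

Notation i0 := (@Ordinal 3 0 isT).
Notation i1 := (@Ordinal 3 1 isT).
Notation i2 := (@Ordinal 3 2 isT).

Lemma ord3P (P : 'I_3 -> Prop) : P i0 -> P i1 -> P i2 -> forall i, P i.
Proof.
move=> P0 P1 P2 [[|[|[|//]]] im].
- by rewrite (_ : Ordinal im = i0) //; exact: val_inj.
- by rewrite (_ : Ordinal im = i1) //; exact: val_inj.
- by rewrite (_ : Ordinal im = i2) //; exact: val_inj.
Qed.

Lemma sum3 (R : nmodType) (F : 'I_3 -> R) : \sum_i F i = F i0 + F i1 + F i2.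
Proof.
rewrite !big_ord_recl big_ord0 addr0 addrA.
by congr (F _ + F _ + F _); exact: val_inj.
Qed.

Definition row3 (R : Type) (x y z : R) : 'rV[R]_3 :=
  \row_j if j == i0 then x else if j == i1 then y else z.

Lemma row3_eta (R : Type) (v : 'rV[R]_3) : v = row3 (v 0 i0) (v 0 i1) (v 0 i2).
Proof. by apply/rowP; apply: ord3P; rewrite !mxE. Qed.

Lemma row3P (R : Type) (u v : 'rV[R]_3) :
  u 0 i0 = v 0 i0 -> u 0 i1 = v 0 i1 -> u 0 i2 = v 0 i2 -> u = v.
Proof. by move=> e0 e1 e2; apply/rowP; apply: ord3P. Qed.

Lemma row3E (R : Type) (x y z : R) :
  (row3 x y z 0 i0 = x) * (row3 x y z 0 i1 = y) * (row3 x y z 0 i2 = z).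
Proof. by rewrite !mxE. Qed.

Section Conic.
Variables (R : comNzRingType) (c : R).
Implicit Types (u v : 'rV[R]_3) (P : R * R).

Definition quad v : R := v 0 i0 * v 0 i1 + c * v 0 i2 ^+ 2.
Definition bil u v : R :=
  u 0 i0 * v 0 i1 + u 0 i1 * v 0 i0 + 2 * c * u 0 i2 * v 0 i2.

Lemma quadD u v : quad (u + v) = quad u + quad v + bil u v.
Proof. by rewrite /quad /bil !mxE; ring. Qed.

Lemma bilDl u u' v : bil (u + u') v = bil u v + bil u' v.
Proof. by rewrite /bil !mxE; ring. Qed.

Lemma bilZl a u v : bil (a *: u) v = a * bil u v.
Proof. by rewrite /bil !mxE; ring. Qed.

Lemma bilC u v : bil u v = bil v u.
Proof. by rewrite /bil; ring. Qed.

(* The points (s : t) of the projective line parametrize the isotropic lines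
   of x y + c z^2; plane P P' is the linear form that vanishes on the lines of
   P and P', and polar P P' spans the orthogonal complement of that plane. *)
Definition conic P : 'rV[R]_3 := row3 (P.1 ^+ 2) (- c * P.2 ^+ 2) (P.1 * P.2).
Definition pdet P P' : R := P.1 * P'.2 - P'.1 * P.2.
Definition plane P P' v : R :=
  - c * P.2 * P'.2 * v 0 i0 + P.1 * P'.1 * v 0 i1
  + c * (P.1 * P'.2 + P'.1 * P.2) * v 0 i2.
Definition polar P P' : 'rV[R]_3 :=
  row3 (2 * P.1 * P'.1) (- 2 * c * P.2 * P'.2) (P.1 * P'.2 + P'.1 * P.2).

Lemma bil_conic P P' : bil (conic P) (conic P') = - c * pdet P P' ^+ 2.
Proof. by rewrite /bil /pdet !row3E; ring. Qed.

Lemma plane_conic P P' P0 :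
  plane P P' (conic P0) = - c * pdet P0 P * pdet P0 P'.
Proof. by rewrite /plane /pdet !row3E; ring. Qed.

Lemma planeD P P' u v : plane P P' (u + v) = plane P P' u + plane P P' v.
Proof. by rewrite /plane !mxE; ring. Qed.

Lemma planeZ P P' a v : plane P P' (a *: v) = a * plane P P' v.
Proof. by rewrite /plane !mxE; ring. Qed.

Lemma planeC P P' v : plane P P' v = plane P' P v.
Proof. by rewrite /plane; ring. Qed.

Lemma pdetii P : pdet P P = 0.
Proof. by rewrite /pdet; ring. Qed.

Lemma plane_polar P P' : plane P P' (polar P P') = c * pdet P P' ^+ 2.
Proof. by rewrite /plane /pdet !row3E; ring. Qed.

Lemma quad_frame P P' x y z :
  quad (x *: conic P + y *: conic P' + z *: polar P P')
  = - c * pdet P P' ^+ 2 * x * y + c * pdet P P' ^+ 2 * z ^+ 2.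
Proof. by rewrite /quad /pdet /conic /polar !mxE /=; ring. Qed.

Lemma frame_expand P P' v :
  (- c * pdet P P' ^+ 2) *: v =
  bil v (conic P') *: conic P + bil v (conic P) *: conic P'
  - plane P P' v *: polar P P'.
Proof. by apply: row3P; rewrite /pdet /plane /bil /conic /polar !mxE /=; ring. Qed.

Section Basis.
Variables (P P' : R * R) (k d : R).
Hypotheses (kE : k * (- c * pdet P P' ^+ 2) = 1) (dE : d * pdet P P' = 1).

(** Together with [quad_basis] and [plane_basis], this describes the vectors on which the linear
    form of the plane is divisible by t: they have a basis in which the quadratic form is x y + c
    t^2 z^2. The last coefficient is displayed with [t * d] split off to fit those two lemmas. *)
Lemma plane_expand t eta v : plane P P' v = t * eta ->
  v = (k * bil v (conic P')) *: conic P + (bil v (conic P) * k) *: conic P'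
      + (- k * eta * pdet P P' * (t * d)) *: polar P P'.
Proof.
move=> vt; have -> : - k * eta * pdet P P' * (t * d) = - (k * plane P P' v).
  rewrite vt; have -> : - k * eta * pdet P P' * (t * d) =
    - (k * (t * eta)) * (d * pdet P P') by ring.
  by rewrite dE mulr1.
rewrite -[LHS]scale1r -kE -scalerA frame_expand scalerBr scalerDr !scalerA scaleNr.
by rewrite (mulrC k (bil v (conic P))).
Qed.

Lemma quad_basis t x y z :
  quad (x *: conic P + (y * k) *: conic P' + (z * (t * d)) *: polar P P')
  = x * y + c * t ^+ 2 * z ^+ 2.
Proof.
rewrite quad_frame.
have -> : - c * pdet P P' ^+ 2 * x * (y * k) + c * pdet P P' ^+ 2 * (z * (t * d)) ^+ 2
  = k * (- c * pdet P P' ^+ 2) * (x * y) + c * t ^+ 2 * z ^+ 2 * (d * pdet P P') ^+ 2.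
  by ring.
by rewrite kE dE expr1n mul1r mulr1.
Qed.

Lemma plane_basis t x y z :
  plane P P' (x *: conic P + y *: conic P' + (z * (t * d)) *: polar P P')
  = t * (z * d * c * pdet P P' ^+ 2).
Proof.
by rewrite !planeD !planeZ !plane_conic !pdetii plane_polar; ring.
Qed.

End Basis.

End Conic.

Section ConicMorphism.
Variables (R S : comNzRingType) (f : {rmorphism R -> S}) (c : R).

Lemma map_quad v : f (quad c v) = quad (f c) (map_mx f v).
Proof. by rewrite /quad !mxE !expr2 rmorphD !rmorphM. Qed.

Definition map_pt (P : R * R) : S * S := (f P.1, f P.2).

Lemma map_pdet P P' : f (pdet P P') = pdet (map_pt P) (map_pt P').
Proof. by rewrite /pdet rmorphB !rmorphM. Qed.

Lemma map_plane P P' v :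
  f (plane c P P' v) = plane (f c) (map_pt P) (map_pt P') (map_mx f v).
Proof. by rewrite /plane !mxE !(rmorphM, rmorphD, rmorphN). Qed.

End ConicMorphism.

Section Hyperbolic.
Variable F : fieldType.
Hypothesis F2 : 2 != 0 :> F.

Lemma hyp_plusE (c : F) (i j : 'I_3) : hyp_plus c i j =
  if (i == i2) || (j == i2) then (if i == j then c else 0)
  else if i == j then 0 else 2^-1.
Proof.
rewrite /hyp_plus !mxE; move: i j.
apply: ord3P; apply: ord3P; case: splitP => [[[|[|k]] kl]|[[|k] kl]] //= e;
  rewrite mxE; case: splitP => [[[|[|l]] ll]|[[|l] ll]] //= e'; rewrite !mxE //.
Qed.

Lemma hyp_plus_sym (c : F) : (hyp_plus c)^T = hyp_plus c.
Proof.
by apply/matrixP; apply: ord3P; apply: ord3P; rewrite mxE !hyp_plusE.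
Qed.

Lemma hyp_plus_quad (c : F) (v : 'rV[F]_3) : (v *m hyp_plus c *m v^T) 0 0 = quad c v.
Proof.
by rewrite mxE sum3 !mxE !sum3 !hyp_plusE /= /quad; field.
Qed.

Lemma hyp_plus_unit (c : F) : c != 0 -> hyp_plus c \in unitmx.
Proof.
move=> c0.
pose G : 'M[F]_3 := \matrix_(i, j)
  if (i == i2) || (j == i2) then (if i == j then c^-1 else 0)
  else if i == j then 0 else 2.
have /mulmx1_unit [] // : hyp_plus c *m G = 1%:M.
apply/matrixP; apply: ord3P; apply: ord3P;
  rewrite mxE sum3 !hyp_plusE !mxE /= ?(mulr0, mul0r, addr0, add0r) ?mulr0n ?mulr1n
    ?(mulVf F2) ?(mulfV c0).
all: reflexivity.
Qed.

(** Polarization on the vectors e_i and e_i + e_j, which are integral; hence testing integer vectors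
    is enough. *)
Lemma quadratic_ext n (A A' : 'M[F]_n) : A^T = A -> A'^T = A' ->
  (forall u : 'rV[int]_n,
     (map_mx intr u *m A *m (map_mx intr u)^T) 0 0 =
     (map_mx intr u *m A' *m (map_mx intr u)^T) 0 0) -> A = A'.
Proof.
have ent (D : 'M[F]_n) i j :
    (('e_i : 'rV[F]_n) *m D *m ('e_j : 'rV[F]_n)^T) 0 0 = D i j.
  by rewrite trmx_delta -rowE -colE !mxE.
have entD (D : 'M[F]_n) i j : D^T = D ->
    (('e_i + 'e_j : 'rV[F]_n) *m D *m ('e_i + 'e_j : 'rV[F]_n)^T) 0 0 = D i i + D j j + 2 * D i j.
  move=> Ds; rewrite linearD /= mulmxDr !mulmxDl.
  have addE (X Y : 'M[F]_1) : (X + Y) 0 0 = X 0 0 + Y 0 0 by rewrite mxE.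
  rewrite !addE !ent (_ : D j i = D i j); last by rewrite -{1}Ds mxE.
  by ring.
move=> As As' Aq; apply/matrixP => i j.
have Ad k : A k k = A' k k.
  by have := Aq 'e_k; rewrite map_delta_mx !ent.
have := Aq ('e_i + 'e_j); rewrite map_mxD !map_delta_mx !entD //.
by rewrite !Ad => /addrI /(mulfI F2).
Qed.

End Hyperbolic.

(** * Local coordinates on a lattice *)

Lemma congruence_unitmx (R : comUnitRingType) n (a : R) (A G : 'M[R]_n) :
  a *: (A *m G *m A^T) \in unitmx -> A \in unitmx.
Proof. by rewrite -mulmxA scalemxAr unitmx_mul => /andP[]. Qed.

Section Frame.
Variable p : nat.
Local Notation Zp := (Zadic p).
Implicit Types (M N K : lattice 3) (V : 'M[Zp]_3) (c : Zp) (x y : 'rV[rat]_3).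

(* The rows of V^-1, applied to the basis of M, form a basis of the completion
   M_p in which the form is x y + c z^2; crd M V gives the coordinates in it. *)
Definition frame M c V : Prop := V \in unitmx /\
  gram_at p M = map_mx tf V *m hyp_plus (tf c) *m (map_mx tf V)^T.

Definition crd M V x : 'rV[Zp]_3 := map_mx intr (zc M x) *m V.

Definition rcrd M V x : 'rV[Fres p]_3 := map_mx (@zres p) (crd M V x).

Lemma locally_hyp_frame M c : locally_hyp M c <-> exists V, frame M c V.
Proof.
split=> [[U Uu e]|[V [Vu e]]].
  have [W Wu We] := Zadic_equiv_sym (ex_intro2 _ _ U Uu e).
  by exists W; rewrite /frame We.
apply: Zadic_equiv_sym; exists V => //.
Qed.

Lemma crdD M V x y : carrier M x -> carrier M y ->
  crd M V (x + y) = crd M V x + crd M V y.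
Proof. by move=> Mx My; rewrite /crd zcD // map_mxD mulmxDl. Qed.

Lemma rcrdD M V x y : carrier M x -> carrier M y ->
  rcrd M V (x + y) = rcrd M V x + rcrd M V y.
Proof. by move=> Mx My; rewrite /rcrd crdD // map_mxD. Qed.

Lemma crd0 M V : crd M V 0 = 0.
Proof.
have := crdD V (carrier0 M) (carrier0 M); rewrite addr0 => /esym/eqP.
by rewrite -subr_eq0 addrK => /eqP.
Qed.

Lemma crd_nat M V k x : carrier M x -> crd M V (k%:R *: x) = k%:R *: crd M V x.
Proof.
move=> Mx; elim: k => [|k IHk]; first by rewrite !scale0r crd0.
by rewrite -(addn1 k) !natrD !scalerDl !scale1r crdD ?IHk //; exact: carrier_nat.
Qed.

Lemma rcrd_nat M V k x : carrier M x -> rcrd M V (k%:R *: x) = k%:R *: rcrd M V x.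
Proof. by move=> Mx; rewrite /rcrd crd_nat // map_mxZ rmorph_nat. Qed.

Lemma crdN M V x : carrier M x -> crd M V (- x) = - crd M V x.
Proof.
move=> Mx; apply/eqP; rewrite -addr_eq0 addrC -crdD ?subrr ?crd0 //.
exact: carrierN.
Qed.

Lemma rcrdN M V x : carrier M x -> rcrd M V (- x) = - rcrd M V x.
Proof. by move=> Mx; rewrite /rcrd crdN // map_mxN. Qed.

Lemma Q_numq M x : integral M -> carrier M x -> Q M x = (numq (Q M x))%:~R.
Proof. by move=> Mi /Mi /numqK. Qed.

Lemma frame_Q M c V x (m : int) : frame M c V -> carrier M x ->
  Q M x = m%:~R -> (m%:~R : Zp) = quad c (crd M V x).
Proof.
move=> [Vu gE] Mx Qm; apply/eqP; rewrite -tofrac_eq; apply/eqP.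
rewrite rmorph_int -(rmorph_int (@qemb p)) -Qm /=.
rewrite (map_quad (@FracField.tofrac Zp)) -hyp_plus_quad ?qadic_nat_neq0 //.
rewrite /crd map_mxM tf_intr_mx trmx_mul !mulmxA.
rewrite -(mulmxA _ (map_mx _ V)) -(mulmxA _ (map_mx _ V *m _)) -gE gram_atE map_trmx.
rewrite -!map_mxM -[X in _ = X]/(map_mx (@qemb p) _ 0 0) [RHS]mxE; congr (qemb p _).
rewrite /Q /B -{1 2}(zcK Mx) trmx_mul !mulmxA map_trmx.
done.
Qed.

Lemma frame_res M c V x (m : int) : frame M c V -> carrier M x ->
  Q M x = m%:~R -> (m%:~R : Fres p) = quad (zres c) (rcrd M V x).
Proof.
move=> fV Mx /(frame_Q fV Mx) e.
by rewrite /rcrd -map_quad -e rmorph_int.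
Qed.

Lemma rcrd_intr M V x :
  rcrd M V x = map_mx intr (zc M x) *m map_mx (@zres p) V.
Proof. by rewrite /rcrd /crd map_mxM zres_intr_mx. Qed.

Lemma rcrd_surj M V (u : 'rV[Fres p]_3) : V \in unitmx ->
  exists2 x, carrier M x & rcrd M V x = u.
Proof.
move=> Vu; have Vu' : map_mx (@zres p) V \in unitmx by exact: rmorph_unitmx.
pose w := map_mx (fun z : Fres p => (z : nat)%:Z) (u *m invmx (map_mx (@zres p) V)).
exists (map_mx intr w *m basis M); first exact: carrier_intr.
rewrite rcrd_intr zcE (_ : map_mx intr w = u *m invmx (map_mx (@zres p) V)) ?mulmxKV //.
by apply/matrixP => i j; rewrite !mxE -pmulrn natr_Zp.
Qed.

Lemma rcrd_eq0 M V x : prime p -> V \in unitmx -> carrier M x ->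
  rcrd M V x = 0 <-> exists2 y, carrier M y & x = p%:R *: y.
Proof.
move=> pp Vu Mx; have Vu' : map_mx (@zres p) V \in unitmx by exact: rmorph_unitmx.
split=> [|[y My ->]]; last first.
  rewrite rcrd_nat //; have /eqP -> : (p%:R : Fres p) == 0.
    by rewrite (Fres_intr_eq0 p p) padic_primeE ?dvdzz.
  by rewrite scale0r.
rewrite rcrd_intr -[RHS](mul0mx _ (map_mx (@zres p) V)) => /(can_inj (mulmxK Vu')) e.
have zp i : zc M x 0 i \in dvdz p.
  have /matrixP/(_ 0 i) := e; rewrite !mxE => /eqP.
  by rewrite Fres_intr_eq0 padic_primeE // mxE.
exists (map_mx intr (\row_i divz (zc M x 0 i) p) *m basis M); first exact: carrier_intr.
rewrite scalemxAl -{1}(zcK Mx); congr (_ *m _); apply/rowP => i.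
rewrite [LHS]mxE [RHS]mxE [in RHS]mxE [in RHS]mxE -[p%:R]/(p%:~R) -rmorphM /=.
by rewrite mulrC divzK.
Qed.

(** The common source of all local computations of sublattices. The rows of R and the basis of K, in
    the coordinates of M, span the same Z_p-module, the vectors whose residue is killed by h. They
    therefore differ by a matrix of GL_3(Z_p), and the frame of K is read off from R. *)
Lemma frame_sub k (h : 'M[Fres p]_(3, k)) M c V K (a : rat) (R : 'M[Zp]_3) c' :
  prime p -> frame M c V -> form K = a *: form M ->
  (forall x, carrier K x <-> carrier M x /\ rcrd M V x *m h = 0) ->
  (forall xi : 'rV[Zp]_3, map_mx (@zres p) xi *m h = 0 <->
     exists u : 'rV[Zp]_3, xi = u *m R) ->
  c' != 0 ->
  (forall u : 'rV[Zp]_3, qemb p a * tf (quad c (u *m R)) = tf (quad c' u)) ->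
  exists2 V', frame K c' V' & forall x, carrier K x -> crd M V x = crd K V' x *m R.
Proof.
move=> pp [Vu gM] fK KE RE c'0 qE.
have KM : carrier K `<=` carrier M by move=> x /KE[].
have pK x : carrier M x -> carrier K (p%:R *: x).
  move=> Mx; apply/KE; split; first exact: carrier_nat.
  rewrite rcrd_nat //; have /eqP -> : (p%:R : Fres p) == 0.
    by rewrite (Fres_intr_eq0 p p) padic_primeE ?dvdzz.
  by rewrite scale0r mul0mx.
have [H KH] := sublattice_basis KM; have [P PH] := sublattice_cobasis KH pK.
pose HZ : 'M[Zp]_3 := map_mx intr H.
have crdK x : carrier K x -> crd M V x = map_mx intr (zc K x) *m (HZ *m V).
  move=> Kx; rewrite /crd mulmxA -map_mxM; congr (map_mx _ _ *m _).
  by rewrite -{1}(zcK Kx) KH mulmxA -map_mxM zcE.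
have [V' V'E] : exists V', HZ *m V = V' *m R.
  have rowE i : exists u, row i (HZ *m V) = u *m R.
    apply/RE; have Kr := row_basis_carrier K i.
    have [_] := (KE _).1 Kr; rewrite /rcrd crdK // => e; apply: etrans e; congr (map_mx _ _ *m _).
    rewrite (_ : row i (basis K) = map_mx intr ('e_i : 'rV[int]_3) *m basis K); last first.
      by rewrite map_delta_mx -rowE.
    by rewrite zcE map_delta_mx -rowE.
  exists (\matrix_i sval (cid (rowE i))); apply/row_matrixP => i.
  by rewrite [RHS]row_mul rowK; case: cid.
have F2 := qadic_nat_neq0 p (isT : (0 < 2)%N).
have hypE : hyp_plus (tf c') =
    qemb p a *: (map_mx tf R *m hyp_plus (tf c) *m (map_mx tf R)^T).
  apply: (quadratic_ext F2) => [||w].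
  - exact: hyp_plus_sym.
  - by rewrite linearZ /= !trmx_mul trmxK hyp_plus_sym mulmxA.
  pose u : 'rV[Zp]_3 := map_mx intr w.
  have -> : map_mx intr w = map_mx tf u.
    by apply/matrixP => i j; rewrite !mxE rmorph_int.
  rewrite -scalemxAr -scalemxAl [RHS]mxE !mulmxA -map_mxM.
  rewrite -(mulmxA (map_mx tf (u *m R) *m _)) -trmx_mul -map_mxM !hyp_plus_quad // -!(map_quad (@FracField.tofrac Zp)).
  by rewrite qE.
have gK : gram_at p K = map_mx tf V' *m hyp_plus (tf c') *m (map_mx tf V')^T.
  rewrite (gram_at_sub p fK KH) -/HZ gM hypE -scalemxAr -scalemxAl; congr (_ *: _).
  rewrite !mulmxA -!map_mxM -V'E -!mulmxA -!trmx_mul -!map_mxM -V'E.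
  by rewrite map_mxM trmx_mul !mulmxA.
(* R is invertible over Q_p because the target form is nondegenerate; this is what lets R be
   cancelled in R = W V' R. *)
have Ru : map_mx tf R \in unitmx.
  apply: (@congruence_unitmx _ _ (qemb p a) _ (hyp_plus (tf c))).
  rewrite -hypE; apply: (hyp_plus_unit F2).
  by rewrite tofrac_eq0.
(* A row of R agrees modulo p with the coordinates of some x in K. The remainder p eta lies in p
   M_p, which P H = p places in K_p. *)
have [W WE] : exists W, R = W *m (HZ *m V).
  have rowE i : exists u, row i R = u *m (HZ *m V).
    have Ri : map_mx (@zres p) (row i R) *m h = 0.
      by apply/RE; exists 'e_i; rewrite -rowE.
    have [x Mx xE] := rcrd_surj M (map_mx (@zres p) (row i R)) Vu.
    have Kx : carrier K x by apply/KE; rewrite xE.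
    have pE j : exists z, (row i R - crd M V x) 0 j = p%:R * z.
      have : zres ((row i R - crd M V x) 0 j) == 0.
        rewrite [X in zres X]mxE [X in _ + X]mxE rmorphB /= subr_eq0.
        by have /matrixP/(_ 0 j) := xE; rewrite mxE [RHS]mxE => ->.
      by case/zres_eq0P => z; rewrite padic_primeE //; exists z.
    pose eta : 'rV[Zp]_3 := \row_j sval (cid (pE j)).
    have eE : row i R - crd M V x = p%:R *: eta.
      by apply/rowP => j; rewrite [RHS]mxE [in RHS]mxE; case: cid.
    exists (map_mx intr (zc K x) + eta *m invmx V *m map_mx intr P).
    rewrite mulmxDl -crdK // -!mulmxA (mulmxA (map_mx _ P)) -map_mxM PH.
    rewrite map_scalar_mx mul_scalar_mx -!scalemxAr mulVmx // mulmx1 -eE.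
    by rewrite addrC subrK.
  exists (\matrix_i sval (cid (rowE i))); apply/row_matrixP => i.
  by rewrite [RHS]row_mul rowK; case: cid.
exists V'; last by move=> x Kx; rewrite crdK // V'E mulmxA.
split=> //.
have WV : W *m V' = 1%:M.
  apply: tf_mx_inj; apply: (can_inj (mulmxK Ru)).
  by rewrite -map_mxM -mulmxA -V'E -WE map_mx1 mul1mx.
by have [] := mulmx1_unit WV.
Qed.

End Frame.

(** * Isotropic lines modulo p and the sublattices of hyperbolic planes *)

Section IsotropicLines.
Variable F : fieldType.
Variable c : F.
Hypothesis c0 : c != 0.

(* None is the point at infinity (0 : 1). *)
Definition proj_pt (a : option F) : F * F := if a is Some t then (1, t) else (0, 1).
Local Notation pt := proj_pt.

Lemma pdet_eq0 a b : (pdet (pt a) (pt b) == 0) = (a == b).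
Proof.
case: a b => [s|] [t|]; rewrite /pdet /=.
- by rewrite !mul1r subr_eq0 eq_sym.
- by rewrite (_ : 1 * 1 - 0 * s = 1) ?oner_eq0 //; ring.
- by rewrite (_ : 0 * t - 1 * 1 = - 1) ?oppr_eq0 ?oner_eq0 //; ring.
- by rewrite (_ : 0 * 1 - 0 * 1 = 0) ?eqxx //; ring.
Qed.

(** If x = 0, then c z^2 = 0 and v is on the line at infinity; otherwise the parameter is z / x. *)
Lemma isotropic_conic (v : 'rV[F]_3) : quad c v = 0 ->
  exists a u, v = u *: conic c (pt a).
Proof.
rewrite /quad => v0; have [x0|x0] := eqVneq (v 0 i0) 0.
  have z0 : v 0 i2 = 0.
    by move/eqP: v0; rewrite x0 mul0r add0r mulf_eq0 (negbTE c0) expf_eq0 /= => /eqP.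
  exists None, (- v 0 i1 / c); apply: row3P; rewrite !mxE /= ?x0 ?z0.
  - by rewrite expr0n mulr0.
  - by rewrite expr1n mulr1; field.
  - by rewrite mul0r mulr0.
exists (Some (v 0 i2 / v 0 i0)), (v 0 i0); apply: row3P; rewrite !mxE /=.
- by rewrite expr1n mulr1.
- have -> : v 0 i1 = - (c * v 0 i2 ^+ 2) / v 0 i0.
    by apply: (mulfI x0); rewrite mulrCA divff // mulr1; apply/eqP; rewrite -addr_eq0 v0.
  by field.
- by field.
Qed.

(** A plane meets the conic in its two defining points only; all incidence counts rest on this. *)
Lemma plane_conic_eq0 a b d u : u != 0 ->
  (plane c (pt a) (pt b) (u *: conic c (pt d)) == 0) = (d == a) || (d == b).
Proof.
move=> u0; rewrite planeZ plane_conic !mulf_eq0 oppr_eq0 (negbTE c0) (negbTE u0) /=.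
by rewrite !pdet_eq0.
Qed.

End IsotropicLines.

Definition plane_col (R : comNzRingType) (c : R) (P P' : R * R) : 'cV[R]_3 :=
  (row3 (- c * P.2 * P'.2) (P.1 * P'.1) (c * (P.1 * P'.2 + P'.1 * P.2)))^T.

Lemma plane_col_eq0 (R : comNzRingType) (c : R) P P' v :
  v *m plane_col c P P' = 0 <-> plane c P P' v = 0.
Proof.
have -> : v *m plane_col c P P' = (plane c P P' v)%:M.
  by apply/matrixP => i j; rewrite !ord1 mxE sum3 !mxE /plane /= mulr1n; ring.
by split=> [/matrixP/(_ 0 0)|->]; rewrite ?raddf0 // !mxE mulr1n.
Qed.

Section Vertex.
Variable p : nat.
Hypothesis pp : prime p.
Local Notation Zp := (Zadic p).
Local Notation F := (Fres p).
Local Notation pt := (@proj_pt F).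
Variable eps : Zp.
Hypothesis eps_unit : eps \is a GRing.unit.
Local Notation e := (zres eps).

Lemma e_neq0 : e != 0.
Proof. by rewrite -zadic_unitE. Qed.

Lemma Fres_p : p%:R = 0 :> F.
Proof. by apply/eqP; rewrite (Fres_intr_eq0 p p) padic_primeE ?dvdzz. Qed.

Definition lift_pt (a : option F) : Zp * Zp :=
  if a is Some t then (1, (t : nat)%:R) else (0, 1).

Lemma map_lift_pt a : map_pt (@zres p) (lift_pt a) = pt a.
Proof.
case: a => [t|]; rewrite /map_pt /= !(rmorph0, rmorph1) //.
by rewrite rmorph_nat natr_Zp.
Qed.

Lemma pdet_lift_unit a b : a != b ->
  pdet (lift_pt a) (lift_pt b) \is a GRing.unit.
Proof. by move=> ab; rewrite zadic_unitE map_pdet !map_lift_pt pdet_eq0. Qed.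

Variables (N : lattice 3) (V : 'M[Zp]_3).
Hypotheses (N_int : integral N) (N_frame : frame N eps V).
Local Notation rc := (rcrd N V).

(* The vectors of N whose residue lies in the hyperbolic plane spanned by the
   isotropic lines a and b. *)
Definition plane_lattice a b : lattice 3 :=
  xget N [set K | form K = form N /\ forall x, carrier K x <->
     carrier N x /\ plane e (pt a) (pt b) (rc x) = 0].

Lemma plane_latticeP a b : form (plane_lattice a b) = form N /\
  forall x, carrier (plane_lattice a b) x <->
    carrier N x /\ plane e (pt a) (pt b) (rc x) = 0.
Proof.
have [K Kf Kc] := ker_lattice N (map_mx (@zres p) V *m plane_col e (pt a) (pt b)).
rewrite /plane_lattice; set P := (X in xget N X).
apply: (@xgetPex _ N P); exists K; split=> // x; rewrite Kc.
by rewrite mulmxA -rcrd_intr plane_col_eq0.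
Qed.

Lemma plane_form a b : form (plane_lattice a b) = form N.
Proof. by have [] := plane_latticeP a b. Qed.

Lemma plane_carrier a b x : carrier (plane_lattice a b) x <->
    carrier N x /\ plane e (pt a) (pt b) (rc x) = 0.
Proof. by have [] := plane_latticeP a b. Qed.

Lemma plane_sub a b : carrier (plane_lattice a b) `<=` carrier N.
Proof. by move=> x /plane_carrier[]. Qed.

Lemma plane_mulp a b x : carrier N x -> carrier (plane_lattice a b) (p%:R *: x).
Proof.
move=> Nx; apply/plane_carrier; split; first exact: carrier_nat.
by rewrite rcrd_nat // Fres_p scale0r -(scale0r 0) planeZ mul0r.
Qed.

Lemma plane_integral a b : integral (plane_lattice a b).
Proof.
by move=> x /plane_sub /N_int; rewrite (Q_form (plane_form a b)).
Qed.

(** The points are lifted to Z_p, where their determinant is still a unit. The two isotropic vectors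
    and p times the polar vector, suitably normalized, are then a basis of the completion, and the
    factor p gives the coefficient eps p^2. *)
Lemma plane_frame a b : a != b ->
  exists W, frame (plane_lattice a b) (eps * p%:R ^+ 2) W.
Proof.
move=> ab; set A := lift_pt a; set C := lift_pt b.
have du := pdet_lift_unit ab; rewrite -/A -/C in du; set d := pdet A C in du.
pose k := (- eps * d ^+ 2)^-1; pose d' := d^-1.
have kE : k * (- eps * d ^+ 2) = 1.
  by rewrite mulVr // unitrM unitrN eps_unit unitrX.
have dE : d' * d = 1 by rewrite mulVr.
pose R : 'M[Zp]_3 := \matrix_i (if i == i0 then conic eps A else
  if i == i1 then k *: conic eps C else (p%:R * d') *: polar eps A C).
have RE (u : 'rV[Zp]_3) : u *m R = u 0 i0 *: conic eps A +
    (u 0 i1 * k) *: conic eps C + (u 0 i2 * (p%:R * d')) *: polar eps A C.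
  by rewrite mulmx_sum_row sum3 !rowK /= !scalerA.
have [||||xi||u|W W1 _] := @frame_sub p _ (plane_col e (pt a) (pt b)) N eps V
  (plane_lattice a b) 1 R (eps * p%:R ^+ 2); last by exists W.
- exact: pp.
- exact: N_frame.
- by rewrite scale1r plane_form.
- by move=> x; rewrite plane_carrier plane_col_eq0.
- rewrite plane_col_eq0 -!map_lift_pt -map_plane -/A -/C.
  split=> [/eqP/zres_eq0P[eta etaE]|[u ->]].
    rewrite padic_primeE // in etaE.
    exists (row3 (k * bil eps xi (conic eps C)) (bil eps xi (conic eps A)) (- k * eta * d)).
    by rewrite RE !row3E; exact: plane_expand.
  by rewrite RE plane_basis rmorphM rmorph_nat Fres_p mul0r.
- rewrite mulf_neq0 //; first by apply: contraTneq eps_unit => ->; rewrite unitr0.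
  by rewrite expf_neq0 // zadic_nat_neq0 // prime_gt0.
- by rewrite rmorph1 mul1r RE (quad_basis kE dE).
Qed.

End Vertex.

(** * The lattices above a vertex *)

Section Lambda.
Variable p : nat.
Hypothesis pp : prime p.
Local Notation Zp := (Zadic p).
Local Notation F := (Fres p).

Lemma Q_congr_res (M : lattice 3) (c : Zp) V x y : integral M -> frame M c V ->
  carrier M x -> carrier M y ->
  (exists m : int, Q M x - Q M y = (p%:Z * m)%:~R) <->
  quad (zres c) (rcrd M V x) = quad (zres c) (rcrd M V y).
Proof.
move=> Mi fV Mx My.
have Qx := Q_numq Mi Mx; have Qy := Q_numq Mi My.
rewrite -(frame_res fV Mx Qx) -(frame_res fV My Qy) Qx Qy.
rewrite -!/(numq _) !numq_int; set a := numq (Q M x); set b := numq (Q M y).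
split=> [[m]|/eqP].
  rewrite -rmorphB /= => /intr_inj ab; apply/eqP; rewrite -subr_eq0 -rmorphB /=.
  by rewrite ab rmorphM /= -pmulrn Fres_p // mul0r.
rewrite -subr_eq0 -rmorphB /= Fres_intr_eq0 padic_primeE // => /dvdzP[m ab].
by exists m; rewrite -rmorphB /= ab mulrC.
Qed.

Lemma Lambda_set_isometry (M N : lattice 3) X x : isometries M N X -> carrier M x ->
  Lambda_set p M x <-> Lambda_set p N (x *m X).
Proof.
move=> MNX Mx; split=> -[_ h].
  split; first exact: isometries_carrier MNX Mx.
  move=> _ /(isometries_preimage MNX)[z Mz ->].
  by rewrite -mulmxDl !(isometries_Q _ MNX); exact: h.
split=> // z Mz; have := h _ (isometries_carrier MNX Mz).
by rewrite -mulmxDl !(isometries_Q _ MNX).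
Qed.

Section Radical.
Variables (M : lattice 3) (c : Zp) (V : 'M[Zp]_3).
Hypotheses (M_int : integral M) (fV : frame M c V) (c0 : zres c = 0).

Definition radical_mx : 'M[F]_(3, 1 + 1) :=
  row_mx (delta_mx i0 0) (delta_mx i1 0).

(** Since c vanishes modulo p, the form there is x y, with the z-axis as radical. In the direct
    implication, z = 0 gives Q(x) = 0 modulo p, and lifts of the first two unit vectors then kill
    both coordinates. *)
Lemma Lambda_set_res x : Lambda_set p M x <->
  carrier M x /\ rcrd M V x *m radical_mx = 0.
Proof.
have E (v : 'rV[F]_3) : v *m radical_mx = 0 <->
    v 0 i0 = 0 /\ v 0 i1 = 0.
  rewrite /radical_mx mul_mx_row -!colE; split=> [e|[v0 v1]].
    have [] := eq_row_mx (etrans e (esym (row_mx0 _ _ _ _))).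
    by move=> /matrixP/(_ 0 0) + /matrixP/(_ 0 0); rewrite !mxE.
  rewrite -[RHS]row_mx0; congr row_mx; apply/matrixP => i j; rewrite !ord1 !mxE //.
have [Vu _] := fV.
split=> -[Mx]; last first.
  move=> /E[v0 v1]; split=> // z Mz; apply/(Q_congr_res M_int fV (carrierD Mx Mz) Mz).
  rewrite (rcrdD V Mx Mz); move: (rcrd M V x) (rcrd M V z) v0 v1 => u w v0 v1.
  by rewrite /quad c0 !mxE v0 v1 !mul0r !add0r.
move=> h; split=> //; apply/E.
have h' z : carrier M z -> quad (zres c) (rcrd M V x + rcrd M V z) = quad (zres c) (rcrd M V z).
  move=> Mz; rewrite -(rcrdD V Mx Mz).
  by apply/(Q_congr_res M_int fV (carrierD Mx Mz) Mz); exact: h.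
have hq : quad (zres c) (rcrd M V x) = 0.
  have := h' 0 (carrier0 M); rewrite /rcrd crd0 map_mx0 addr0 => ->.
  by rewrite /quad !mxE mul0r expr0n mulr0 addr0.
have hb w : bil (zres c) (rcrd M V x) w = 0.
  have [z Mz <-] := rcrd_surj M w Vu; have := h' z Mz.
  by rewrite quadD hq add0r => /eqP; rewrite addrC -subr_eq0 addrK => /eqP.
split.
  have := hb (row3 0 1 0); rewrite /bil !row3E c0.
  by rewrite !(mulr1, mulr0, mul0r, addr0).
have := hb (row3 1 0 0); rewrite /bil !row3E c0.
by rewrite !(mulr1, mulr0, mul0r, addr0, add0r).
Qed.

Lemma LambdaP : form (Lambda p M) = form M /\ carrier (Lambda p M) = Lambda_set p M.
Proof.
have [K Kf Kc] := ker_lattice M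
  (map_mx (@zres p) V *m radical_mx).
rewrite /Lambda; set P := (X in xget M X).
apply: (@xgetPex _ M P); exists K; split=> //.
apply/seteqP; split=> x; first by move/Kc; rewrite mulmxA -rcrd_intr => /Lambda_set_res.
by move/Lambda_set_res; rewrite rcrd_intr -mulmxA => /Kc.
Qed.

Lemma lambda_form : form (lambda p M) = (p%:R ^- 2) *: form M.
Proof.
rewrite /lambda scaleE; first by rewrite (LambdaP.1).
by rewrite invr_gt0 exprn_gt0 // ltr0n prime_gt0.
Qed.

Lemma lambda_carrier : carrier (lambda p M) = Lambda_set p M.
Proof. by rewrite -(LambdaP.2). Qed.

Lemma Lambda_set_mulp x : carrier M x -> Lambda_set p M (p%:R *: x).
Proof.
move=> Mx; apply/Lambda_set_res; split; first exact: carrier_nat.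
by rewrite rcrd_nat // Fres_p // scale0r mul0mx.
Qed.

End Radical.

Section Vertex.
Variables (eps : Zp) (N : lattice 3) (V : 'M[Zp]_3).
Hypothesis eps_unit : eps \is a GRing.unit.
Hypotheses (N_int : integral N) (N_frame : frame N eps V).
Local Notation e := (zres eps).
Local Notation pt := (@proj_pt F).
Local Notation rc := (rcrd N V).
Local Notation Nab := (plane_lattice eps N V).

Let e0 : e != 0. Proof. exact: e_neq0. Qed.
Let Vu : V \in unitmx. Proof. by case: N_frame. Qed.

Lemma plane_conicP (v : 'rV[F]_3) a b : a != b -> plane e (pt a) (pt b) v = 0 ->
  exists s t, v = s *: conic e (pt a) + t *: conic e (pt b).
Proof.
move=> ab v0; have d0 : - e * pdet (pt a) (pt b) ^+ 2 != 0.
  by rewrite mulf_neq0 ?oppr_eq0 // expf_neq0 // pdet_eq0.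
have := frame_expand e (pt a) (pt b) v; rewrite v0 scale0r subr0 => h.
set D := - e * _ in d0 h.
exists (D^-1 * bil e v (conic e (pt b))), (D^-1 * bil e v (conic e (pt a))).
by rewrite -!scalerA -scalerDr -h scalerA mulVf // scale1r.
Qed.

(** This is why lambda_p of a plane sublattice gives back N: the residues form a hyperbolic plane,
    which is nondegenerate, so a vector of Lambda_p has residue 0. *)
Lemma Lambda_plane a b x : a != b ->
  Lambda_set p (Nab a b) x <-> exists2 y, carrier N y & x = p%:R *: y.
Proof.
move=> ab; have Qf := Q_form (plane_form eps N V a b).
split=> [[/plane_carrier[Nx xab] h]|[y Ny ->]]; last first.
  split; first exact: plane_mulp.
  move=> z /plane_carrier[Nz _]; rewrite Qf.
  have Npy := carrier_nat p Ny.
  apply/(Q_congr_res N_int N_frame (carrierD Npy Nz) Nz).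
  by rewrite (rcrdD V Npy Nz) (rcrd_nat V p Ny) (Fres_p pp) scale0r add0r.
rewrite -(rcrd_eq0 pp Vu Nx).
have h' z : carrier N z -> plane e (pt a) (pt b) (rc z) = 0 ->
    quad e (rc x + rc z) = quad e (rc z).
  move=> Nz zab; rewrite -(rcrdD V Nx Nz).
  apply/(Q_congr_res N_int N_frame (carrierD Nx Nz) Nz).
  by rewrite -Qf; apply: h; apply/plane_carrier.
have hq : quad e (rc x) = 0.
  have r0 : rc 0 = 0 by rewrite /rcrd crd0 map_mx0.
  have := h' 0 (carrier0 N); rewrite r0 addr0 => ->.
    by rewrite /quad !mxE mul0r expr0n mulr0 addr0.
  by rewrite -(scale0r 0) planeZ mul0r.
have hb w : plane e (pt a) (pt b) w = 0 -> bil e (rc x) w = 0.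
  have [z Nz <-] := rcrd_surj N w Vu => zab; have := h' z Nz zab.
  by rewrite quadD hq add0r => /eqP; rewrite addrC -subr_eq0 addrK => /eqP.
have [s [t xE]] := plane_conicP ab xab.
have pa : plane e (pt a) (pt b) (conic e (pt a)) = 0.
  by rewrite plane_conic pdetii mulr0 mul0r.
have pb : plane e (pt a) (pt b) (conic e (pt b)) = 0.
  by rewrite plane_conic pdetii mulr0.
have d0 : - e * pdet (pt a) (pt b) ^+ 2 != 0.
  by rewrite mulf_neq0 ?oppr_eq0 // expf_neq0 // pdet_eq0.
have d0' : - e * pdet (pt b) (pt a) ^+ 2 != 0.
  by rewrite mulf_neq0 ?oppr_eq0 // expf_neq0 // pdet_eq0 eq_sym.
have := hb _ pb; rewrite xE bilDl !bilZl !bil_conic pdetii expr0n mulr0 mulr0 addr0.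
move=> /eqP; rewrite mulf_eq0 (negbTE d0) orbF => /eqP ->.
have := hb _ pa; rewrite xE bilDl !bilZl !bil_conic pdetii expr0n mulr0 mulr0 add0r.
move=> /eqP; rewrite mulf_eq0 (negbTE d0') orbF => /eqP ->.
by rewrite !scale0r addr0.
Qed.

Section Embedding.
Variables (S : lattice 3) (W : 'M[Zp]_3).
Hypotheses (S_int : integral S) (S_frame : frame S (eps * p%:R ^+ 2) W).

Let c0 : zres (eps * p%:R ^+ 2) = 0.
Proof. by rewrite rmorphM rmorphXn rmorph_nat /= Fres_p // expr0n mulr0. Qed.

(* The hyperbolic pair of residues of S goes to vectors on two distinct
   isotropic lines a, b. The rest of S, orthogonal to everything modulo p, goes
   to isotropic residues orthogonal to both lines, hence to 0. *)
Lemma image_plane Y : preserves_form S N Y ->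
  image_lattice Y S `<=` carrier N ->
  (forall x, carrier N x -> image_lattice Y S (p%:R *: x)) ->
  exists a b, a != b /\ isometries S (Nab a b) Y.
Proof.
move=> Yf YN pY; have [Wu _] := S_frame.
have NY s : carrier S s -> carrier N (s *m Y) by move=> Ss; apply: YN; exists s.
have QY s : carrier S s -> quad e (rc (s *m Y)) =
    rcrd S W s 0 i0 * rcrd S W s 0 i1.
  move=> Ss; have Qs := Q_numq S_int Ss.
  rewrite -(frame_res N_frame (NY s Ss) (etrans (Yf s s) Qs)).
  by rewrite (frame_res S_frame Ss Qs) c0 /quad mul0r addr0.
have [s1 S1 r1] := rcrd_surj S (row3 1 0 0 : 'rV[F]_3) Wu.
have [s2 S2 r2] := rcrd_surj S (row3 0 1 0 : 'rV[F]_3) Wu.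
have q1 : quad e (rc (s1 *m Y)) = 0 by rewrite QY // r1 !row3E mulr0.
have q2 : quad e (rc (s2 *m Y)) = 0 by rewrite QY // r2 !row3E mul0r.
have q12 : bil e (rc (s1 *m Y)) (rc (s2 *m Y)) = 1.
  have := QY _ (carrierD S1 S2).
  rewrite mulmxDl (rcrdD V (NY _ S1) (NY _ S2)) quadD q1 q2 !add0r => ->.
  by rewrite (rcrdD W S1 S2) r1 r2 !mxE /= addr0 add0r mulr1.
have [a [u1 e1]] := isotropic_conic e0 q1.
have [b [u2 e2]] := isotropic_conic e0 q2.
move: q12; rewrite e1 e2 bilZl bilC bilZl bil_conic => q12.
have u10 : u1 != 0 by apply: contra_eq_neq q12 => ->; rewrite mul0r eq_sym oner_neq0.
have u20 : u2 != 0 by apply: contra_eq_neq q12 => ->; rewrite mul0r mulr0 eq_sym oner_neq0.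
have ab : a != b.
  apply: contra_eq_neq q12 => ->; rewrite pdetii expr0n !mulr0 eq_sym.
  exact: oner_neq0.
exists a, b; split=> //; split=> [x y|].
  by rewrite (B_form (plane_form eps N V a b)).
have p1 : plane e (pt a) (pt b) (rc (s1 *m Y)) = 0.
  by rewrite e1 planeZ plane_conic pdetii mulr0 mul0r mulr0.
have p2 : plane e (pt a) (pt b) (rc (s2 *m Y)) = 0.
  by rewrite e2 planeZ plane_conic pdetii mulr0 mulr0.
have imD (x y : 'rV[rat]_3) : image_lattice Y S x -> image_lattice Y S y -> image_lattice Y S (x + y).
  move=> [s Ss <-] [t St <-]; exists (s + t); first exact: carrierD.
  by rewrite mulmxDl.
have lift2 (s t : F) x : carrier N x ->
    rc x = s *: rc (s1 *m Y) + t *: rc (s2 *m Y) ->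
    exists2 y, carrier N y & x = ((s : nat)%:R *: s1 + (t : nat)%:R *: s2) *m Y + p%:R *: y.
  move=> Nx xE; have N1 := NY _ S1; have N2 := NY _ S2.
  set w := (_ *: s1 + _) *m Y.
  have Nw : carrier N w by apply: NY; apply: carrierD; exact: carrier_nat.
  have : rc (x - w) = 0.
    rewrite rcrdD ?rcrdN //; last exact: carrierN.
    rewrite /w mulmxDl -!scalemxAl rcrdD; [|exact: carrier_nat..].
    by rewrite !rcrd_nat // !natr_Zp xE subrr.
  move/(rcrd_eq0 pp Vu (carrierB Nx Nw)) => [y Ny yE]; exists y => //.
  by rewrite -yE addrC subrK.
apply/seteqP; split=> x.
  move=> [s Ss <-]; apply/plane_carrier; split; first exact: NY.
  set r := rcrd S W s.
  pose s0 := s - ((r 0 i0 : nat)%:R *: s1 + (r 0 i1 : nat)%:R *: s2).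
  have S12 : carrier S ((r 0 i0 : nat)%:R *: s1 + (r 0 i1 : nat)%:R *: s2).
    by apply: carrierD; exact: carrier_nat.
  have S0 : carrier S s0 by exact: carrierB.
  have r0 : rcrd S W s0 = row3 0 0 (r 0 i2).
    rewrite rcrdD ?rcrdN //; last exact: carrierN.
    rewrite rcrdD; [|exact: carrier_nat..].
    rewrite !rcrd_nat // r1 r2 !natr_Zp -/r.
    by apply: row3P; rewrite !mxE /=; ring.
  have qs0 z : carrier S z -> bil e (rc (s0 *m Y)) (rc (z *m Y)) =
      bil (0 : F) (row3 0 0 (r 0 i2)) (rcrd S W z).
    move=> Sz; have := QY _ (carrierD S0 Sz).
    rewrite mulmxDl (rcrdD V (NY _ S0) (NY _ Sz)) quadD (QY _ S0) (QY _ Sz).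
    rewrite (rcrdD W S0 Sz) r0 /bil; move: (rcrd S W z) => w.
    have -> : (row3 0 0 (r 0 i2) + w) 0 i0 = w 0 i0 by rewrite mxE row3E add0r.
    have -> : (row3 0 0 (r 0 i2) + w) 0 i1 = w 0 i1 by rewrite mxE row3E add0r.
    rewrite !row3E !(mul0r, add0r, mulr0) => /eqP.
    by rewrite addrC -subr_eq0 addrK => /eqP.
  have q0 : quad e (rc (s0 *m Y)) = 0 by rewrite QY // r0 !row3E mul0r.
  have b1 : bil e (rc (s0 *m Y)) (u1 *: conic e (pt a)) = 0.
    by rewrite -e1 qs0 // r1 /bil !row3E !(mul0r, mulr0, addr0).
  have b2 : bil e (rc (s0 *m Y)) (u2 *: conic e (pt b)) = 0.
    by rewrite -e2 qs0 // r2 /bil !row3E !(mul0r, mulr0, addr0).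
  have w0 : rc (s0 *m Y) = 0.
    have [d [u ed]] := isotropic_conic e0 q0.
    have [u0|u0] := eqVneq u 0; first by rewrite ed u0 scale0r.
    have eq_pt f u' : u' != 0 -> bil e (rc (s0 *m Y)) (u' *: conic e (pt f)) = 0 -> d = f.
      move=> u'0; rewrite ed bilC bilZl bilC bilZl bil_conic => /eqP.
      rewrite expr2 !mulf_eq0 (negbTE u0) (negbTE u'0) oppr_eq0 (negbTE e0) /=.
      by rewrite pdet_eq0 orbb => /eqP.
    by move: ab; rewrite -(eq_pt _ _ u10 b1) -(eq_pt _ _ u20 b2) eqxx.
  have -> : s *m Y = s0 *m Y + ((r 0 i0 : nat)%:R *: s1 + (r 0 i1 : nat)%:R *: s2) *m Y.
    by rewrite -mulmxDl /s0 subrK.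
  have [N1 N2] := (NY _ S1, NY _ S2).
  rewrite (rcrdD V (NY _ S0) (NY _ S12)) w0 add0r mulmxDl -!scalemxAl.
  rewrite (rcrdD V (carrier_nat _ N1) (carrier_nat _ N2)).
  rewrite (rcrd_nat V _ N1) (rcrd_nat V _ N2); move: (rc _) (rc _) p1 p2 => w1 w2 p1 p2.
  by rewrite planeD !planeZ p1 p2 !mulr0 addr0.
(* Conversely, a vector of the plane sublattice agrees modulo pN with an integral combination of the
   images of [s1] and [s2], and the image contains pN. *)
move=> /plane_carrier[Nx /(plane_conicP ab)[s [t xE]]].
have [||y Ny ->] := lift2 (s / u1) (t / u2) x => //.
  by rewrite e1 e2 !scalerA !divfK.
apply: imD; last exact: pY.
exists ((s / u1 : nat)%:R *: s1 + (t / u2 : nat)%:R *: s2) => //.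
by apply: carrierD; exact: carrier_nat.
Qed.

(** If X maps Lambda_p(S) onto N, then pX preserves the original form, and its image contains pN
    because S contains Lambda_p(S); [image_plane] applies. Conversely, Lambda_p is intrinsic, so pX
    maps Lambda_p(S) onto that of the plane sublattice, which is pN. *)
Lemma isometries_lambda X : isometries (lambda p S) N X <->
  exists a b, a != b /\ isometries S (Nab a b) (p%:R *: X).
Proof.
have p0 : p%:R != 0 :> rat by rewrite pnatr_eq0 -lt0n prime_gt0.
have lf := lambda_form S_int S_frame c0; have lc := lambda_carrier S_int S_frame c0.
have S_mulp := Lambda_set_mulp S_int S_frame c0.
split=> [[Xf Xc]|[a [b [ab abX]]]].
  apply: image_plane.
  - move=> x y; rewrite -!scalemxAr BZl BZr Xf (B_formZ _ _ lf).
    by rewrite mulrA -expr2 mulrA divff ?mul1r // expf_neq0.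
  - move=> _ [s Ss <-]; rewrite -scalemxAr scalemxAl -Xc.
    by exists (p%:R *: s) => //; rewrite lc; exact: S_mulp.
  - move=> x; rewrite -Xc => -[s]; rewrite lc => -[Ss _] <-.
    by exists s; rewrite // scalemxAr.
have [Xf Xc] := abX.
split=> [x y|].
  rewrite (B_formZ _ _ lf) -(Xf x y) -!scalemxAr BZl BZr.
  rewrite (B_form (plane_form eps N V a b)) [p%:R * (_ * _)]mulrA -expr2.
  by rewrite mulrA mulVf ?mul1r // expf_neq0.
apply/seteqP; split=> x.
  move=> [s]; rewrite lc => Ls <-; have Ss : carrier S s by case: Ls.
  move: Ls => /(Lambda_set_isometry abX Ss)/(Lambda_plane _ ab)[y Ny].
  by rewrite -scalemxAr => /(scalerI p0) ->.
move=> Nx; have : Lambda_set p (Nab a b) (p%:R *: x) by apply/Lambda_plane => //; exists x.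
move=> Lx; have [s Ss sE] := isometries_preimage abX Lx.1.
exists s; last by apply: (scalerI p0); rewrite sE scalemxAr.
by rewrite lc; apply/(Lambda_set_isometry abX Ss); rewrite -sE.
Qed.

End Embedding.
End Vertex.
End Lambda.

(** * Counting *)

(* Selects one representative of each unordered pair. *)
Definition rank_lt (I : finType) (ab : I * I) : bool :=
  (enum_rank ab.1 < enum_rank ab.2)%N.

Lemma rank_lt_neq (I : finType) (a b : I) : rank_lt (a, b) -> a != b.
Proof. by apply: contraTneq => ->; rewrite /rank_lt ltnn. Qed.

Lemma rank_lt_total (I : finType) (a b : I) : a != b ->
  rank_lt (a, b) || rank_lt (b, a).
Proof. by rewrite /rank_lt -neq_ltn (inj_eq val_inj) (inj_eq enum_rank_inj). Qed.

Lemma sum_rank_lt (I : finType) (g : I -> I -> nat) :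
  (forall a b, g a b = g b a) ->
  (2 * \sum_(ab | rank_lt ab) g ab.1 ab.2 = \sum_a \sum_(b | b != a) g a b)%N.
Proof.
move=> gC; rewrite pair_big_dep /= [RHS](bigID (@rank_lt I)) /= mul2n -addnn.
congr (_ + _)%N.
  apply: eq_bigl => -[a b] /=; case: (boolP (rank_lt (a, b))) => [h|]; rewrite ?andbF //.
  by rewrite eq_sym (rank_lt_neq h).
rewrite (reindex_inj (h := fun ab => (ab.2, ab.1))) /=; last by move=> [a b] [c d] [-> ->].
apply: eq_big => [[a b]|[a b] _] /=; last exact: gC.
have [->|ab] := eqVneq b a; first by rewrite /rank_lt ltnn.
have nab : enum_rank b != enum_rank a :> nat.
  by rewrite (inj_eq val_inj) (inj_eq enum_rank_inj).
by rewrite /rank_lt /= -leqNgt ltn_neqAle nab.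
Qed.

Section Vertex.
Variable p : nat.
Hypothesis pp : prime p.
Local Notation Zp := (Zadic p).
Local Notation F := (Fres p).
Local Notation I := (option F).
Local Notation pt := (@proj_pt F).

Lemma card_Fres : #|F| = p.
Proof. by rewrite card_Fp ?padic_primeP // padic_primeE. Qed.

Lemma card_line : #|{: I}| = p.+1.
Proof. by rewrite card_option card_Fres. Qed.

Lemma sum_neq (I' : finType) (a : I') : (\sum_(b | b != a) 1 = #|I'|.-1)%N.
Proof. by rewrite sum1_card cardC1. Qed.

Section Plane.
Variable e : F.
Hypothesis e0 : e != 0.

(** A nonzero isotropic vector lies on one line, hence in the p planes through it; the zero vector
    lies in all p (p + 1) / 2. Doubling allows ordered pairs to be counted. *)
Lemma count_planes v : quad e v = 0 ->
  (2 * \sum_(ab : I * I | rank_lt ab) (plane e (pt ab.1) (pt ab.2) v == 0%R)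
   = 2 * p + (v == 0%R) * (p ^ 2 - p))%N.
Proof.
move=> qv; have p1 := prime_gt1 pp.
rewrite (@sum_rank_lt _ (fun a b => plane e (pt a) (pt b) v == 0%R)); last first.
  by move=> a b; rewrite planeC.
have [d [u vE]] := isotropic_conic e0 qv.
have [->|v0] := eqVneq v 0.
  have z a b : plane e (pt a) (pt b) 0 = 0 by rewrite -(scale0r 0) planeZ mul0r.
  rewrite (eq_bigr (fun=> p)); last first.
    move=> a _; rewrite (eq_bigr (fun=> 1%N)) => [|b _]; last by rewrite z eqxx.
    by rewrite sum_neq card_line.
  by rewrite sum_nat_const card_line /=; nia.
have u0 : u != 0 by apply: contraNneq v0 => u0; rewrite vE u0 scale0r.
have cE a b : (plane e (pt a) (pt b) v == 0) = (d == a) || (d == b).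
  by rewrite vE (plane_conic_eq0 e0 _ _ _ u0).
(* Ordered pairs starting with d give p, and those ending with d give p again. *)
rewrite (bigD1 d) // mul0n addn0 mul2n -addnn; congr (_ + _)%N.
  rewrite (eq_bigr (fun=> 1%N)) => [|b _]; last by rewrite cE eqxx.
  by rewrite sum_neq card_line.
rewrite -[RHS]/(p.+1.-1) -card_line -(sum_neq d); apply: eq_bigr => a ad.
rewrite (bigD1 d) ?(eq_sym d) // cE eqxx orbT big1 // => b /andP[_ bd].
by rewrite cE !(eq_sym d) (negbTE bd) (negbTE (andP ad).2).
Qed.

(** Vectors of the line [None], spanned by (0, 1, 0), lie in all p planes through it; any other
    isotropic vector lies only in the plane that joins its line to [None]. *)
Lemma count_planes_line v : quad e v = 0 ->
  (\sum_(t : F) (plane e (pt None) (pt (Some t)) v == 0%R)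
   = 1 + ((v 0%R i0 == 0%R) && (v 0%R i2 == 0%R)) * (p - 1))%N.
Proof.
move=> qv; have p1 := prime_gt1 pp.
have [d [u vE]] := isotropic_conic e0 qv.
have [v0|v0] := eqVneq v 0.
  have z a b : plane e (pt a) (pt b) 0 = 0 by rewrite -(scale0r 0) planeZ mul0r.
  rewrite (eq_bigr (fun=> 1%N)) => [|t _]; last by rewrite v0 z eqxx.
  rewrite sum1_card card_Fres v0 !mxE !eqxx /=; lia.
have u0 : u != 0 by apply: contraNneq v0 => u0; rewrite vE u0 scale0r.
have cE t : (plane e (pt None) (pt (Some t)) v == 0) = (d == None) || (d == Some t).
  by rewrite vE (plane_conic_eq0 e0 _ _ _ u0).
case: d vE cE => [t|] vE cE; last first.
  rewrite (eq_bigr (fun=> 1%N)) => [|t _]; last by rewrite cE eqxx.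
  rewrite sum1_card card_Fres vE !mxE /= expr0n mul0r mulr0 !eqxx /=; lia.
rewrite (bigD1 t) // cE eqxx big1 ?addn0; last first.
  by move=> s /negbTE st; rewrite cE orFb -[_ == _]/(t == s) eq_sym st.
rewrite vE !mxE /= expr1n mulr1 (negbTE u0) //.
Qed.

End Plane.

Section Lattices.
Variables (eps : Zp) (N : lattice 3) (V : 'M[Zp]_3).
Hypothesis eps_unit : eps \is a GRing.unit.
Hypotheses (N_int : integral N) (N_frame : frame N eps V).
Local Notation e := (zres eps).
Local Notation rc := (rcrd N V).
Local Notation Nab := (plane_lattice eps N V).

Let e0 : e != 0. Proof. exact: e_neq0. Qed.
Let Vu : V \in unitmx. Proof. by case: N_frame. Qed.
Let p_neq0 : p%:R != 0 :> rat.
Proof. by rewrite pnatr_eq0 -lt0n prime_gt0. Qed.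

Local Notation sph k := [set x | carrier N x /\ Q N x = k%:~R].

Lemma cnt_sphere (k : int) (P : 'rV[rat]_3 -> Prop) :
  cnt [set x | (carrier N x /\ Q N x = k%:~R) /\ P x] =
  (\sum_(x <- fset_set (sph k)) `[< P x >])%N.
Proof.
rewrite (cntE (finite_sphere N k%:~R)); last by move=> x [].
apply: eq_big_seq => x /(fset_setP _ (finite_sphere N _)) hx; congr nat_of_bool.
by apply/asboolP/asboolP => [[]|].
Qed.

Lemma r_plane k a b : r k (Nab a b) =
  (\sum_(x <- fset_set (sph k)) (plane e (pt a) (pt b) (rc x) == 0%R))%N.
Proof.
transitivity (cnt [set x | (carrier N x /\ Q N x = k%:~R)
    /\ plane e (pt a) (pt b) (rc x) = 0]).
  congr (cnt _); apply/seteqP; split=> x /=.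
    by move=> [/plane_carrier[Nx h]]; rewrite (Q_form (plane_form eps N V a b)).
  move=> [[Nx Qx] h]; rewrite (Q_form (plane_form eps N V a b)); split=> //.
  exact/plane_carrier.
rewrite cnt_sphere; apply: eq_bigr => x _; congr nat_of_bool.
by apply/asboolP/eqP.
Qed.

Lemma sphere_isotropic (k : int) x : carrier N x -> Q N x = (p%:Z * k)%:~R ->
  quad e (rc x) = 0.
Proof.
move=> Nx /(frame_res N_frame Nx) <-.
by rewrite rmorphM /= -pmulrn Fres_p // mul0r.
Qed.

Lemma r_mulp (k : int) : cnt [set x | (carrier N x /\ Q N x = (p%:Z ^+ 2 * k)%:~R) /\ rc x = 0]
  = r k N.
Proof.
rewrite /r -(@cnt_image _ _ (fun x => p%:R *: x) (sph k)).
- congr (cnt _); apply/seteqP; split=> x /=.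
    move=> [[Nx Qx] /(rcrd_eq0 pp Vu Nx)[y Ny xE]]; exists y => //; split=> //.
    move: Qx; rewrite xE QZ rmorphM rmorphXn /= -pmulrn => /mulfI; apply.
    by rewrite expf_neq0.
  move=> [y [Ny Qy] <-]; split; last by apply/(rcrd_eq0 pp Vu (carrier_nat p Ny)); exists y.
  by split; [exact: carrier_nat|rewrite QZ Qy rmorphM rmorphXn /= -pmulrn].
- exact: finite_sphere.
- by move=> x y _ _; exact: scalerI.
Qed.

Lemma sum_r_planes (n : int) :
  (2 * \sum_(ab : I * I | rank_lt ab) r (p%:Z ^+ 3 * n) (Nab ab.1 ab.2) =
   2 * p * r (p%:Z ^+ 3 * n) N + (p ^ 2 - p) * r (p%:Z * n) N)%N.
Proof.
(* Here r(pn, N) becomes the number of vectors of pN on the sphere of norm p^3 n, so that all terms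
   are sums over that sphere. *)
rewrite -(r_mulp (p%:Z * n)) mulrA -exprSr cnt_sphere.
rewrite (eq_bigr _ (fun ab _ => r_plane (p%:Z ^+ 3 * n) ab.1 ab.2)).
rewrite exchange_big big_distrr /= /r card_fset_sum1 !big_distrr -big_split /=.
apply: eq_big_seq => x /(fset_setP _ (finite_sphere N _))[Nx Qx].
rewrite count_planes //; last first.
  by apply: (@sphere_isotropic (p%:Z ^+ 2 * n)) => //; rewrite mulrA -exprS.
have -> : (rc x == 0) = `[< rc x = 0 >] by apply/eqP/asboolP.
by rewrite muln1 [in RHS](mulnC (_ - _)%N).
Qed.

Lemma sum_r_planes_line (k : int) :
  (\sum_(t : F) r (p%:Z * k) (Nab None (Some t)) = r (p%:Z * k) N + (p - 1) *
    cnt [set x | (carrier N x /\ Q N x = (p%:Z * k)%:~R) /\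
                 rc x 0%R i0 = 0%R /\ rc x 0%R i2 = 0%R])%N.
Proof.
rewrite (eq_bigr _ (fun t _ => r_plane (p%:Z * k) None (Some t))).
rewrite cnt_sphere exchange_big /= /r card_fset_sum1 big_distrr -big_split /=.
apply: eq_big_seq => x /(fset_setP _ (finite_sphere N _))[Nx Qx].
rewrite count_planes_line //; last exact: sphere_isotropic Nx Qx.
have -> : (rc x 0 i0 == 0) && (rc x 0 i2 == 0) = `[< rc x 0 i0 = 0 /\ rc x 0 i2 = 0 >].
  by apply/andP/asboolP => -[h1 h2]; split; apply/eqP.
by rewrite mulnC.
Qed.

Lemma plane_carrier_conic a b d x : carrier N x -> rc x = conic e (pt d) ->
  carrier (Nab a b) x <-> (d == a) || (d == b).
Proof.
move=> Nx xE; rewrite plane_carrier xE -[conic _ _]scale1r.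
rewrite -(plane_conic_eq0 e0 a b d (oner_neq0 _)).
by split=> [[_ ->]|/eqP h] //; split.
Qed.

Lemma plane_carrierC a b : carrier (Nab a b) = carrier (Nab b a).
Proof. by apply/seteqP; split=> x /plane_carrier h; apply/plane_carrier; rewrite planeC. Qed.

(** The pair is recovered as the set of isotropic lines whose lifts belong to the sublattice. *)
Lemma plane_carrier_inj a b a' b' : a != b ->
  carrier (Nab a b) = carrier (Nab a' b') -> (a, b) = (a', b') \/ (a, b) = (b', a').
Proof.
move=> ab ee.
have h d : d = a \/ d = b -> (d == a') || (d == b').
  move=> dab; have [x Nx xE] := rcrd_surj N (conic e (pt d)) Vu.
  apply/(plane_carrier_conic _ _ Nx xE); rewrite -ee.
  by apply/(plane_carrier_conic _ _ Nx xE); case: dab => ->; rewrite eqxx ?orbT.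
have /orP[/eqP ea|/eqP ea] := h a (or_introl erefl);
have /orP[/eqP eb|/eqP eb] := h b (or_intror erefl).
- by rewrite ea eb eqxx in ab.
- by left; rewrite ea eb.
- by right; rewrite ea eb.
- by rewrite ea eb eqxx in ab.
Qed.

Lemma isometries_planeC S a b : isometries S (Nab a b) = isometries S (Nab b a).
Proof.
by apply: isometries_eq; [rewrite !plane_form|exact: plane_carrierC].
Qed.

Lemma cnt_isometries_lambda S W : integral S ->
  frame S (eps * p%:R ^+ 2) W ->
  cnt (isometries (lambda p S) N) =
  (\sum_(ab : I * I | rank_lt ab) cnt (isometries S (Nab ab.1 ab.2)))%N.
Proof.
move=> Si Sf; have lamP := isometries_lambda pp eps_unit N_int N_frame Si Sf.
rewrite -(@cnt_image _ _ (fun X => p%:R *: X) _ (finite_isometries _ _)); last first.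
  by move=> x y _ _; exact: scalerI.
apply: cnt_bigU => [ab _|X|[a b] [a' b'] X /= lab lab' [_ h] [_ h']].
- exact: finite_isometries.
- split=> [[Y /lamP[a [b [ab h]]] <-]|[[a b] /rank_lt_neq ab h]].
    have /orP[lab|lab] := rank_lt_total ab; first by exists (a, b).
    by exists (b, a); rewrite // isometries_planeC.
  exists (p%:R^-1 *: X); last by rewrite scalerA divff // scale1r.
  by apply/lamP; exists a, b; rewrite scalerA divff // scale1r.
have [//|[ea eb]] := plane_carrier_inj (rank_lt_neq lab) (etrans (esym h) h').
by move: lab lab'; rewrite /rank_lt /= ea eb => /ltnW; rewrite leqNgt => /negbTE ->.
Qed.

End Lattices.
End Vertex.

(** * The two neighbours of T *)

Lemma mulf_eq0_or (R : idomainType) (a b : R) : a * b = 0 -> a = 0 \/ b = 0.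
Proof. by move/eqP; rewrite mulf_eq0 => /orP[] /eqP; [left|right]. Qed.

Section Edge.
Variable p : nat.
Hypothesis pp : prime p.
Local Notation Zp := (Zadic p).
Local Notation F := (Fres p).
Local Notation I := (option F).
Local Notation pt := (@proj_pt F).
Variable eps : Zp.
Hypothesis eps_unit : eps \is a GRing.unit.
Local Notation e := (zres eps).

Let p_neq0 : p%:R != 0 :> rat.
Proof. by rewrite pnatr_eq0 -lt0n prime_gt0. Qed.
Let eps_neq0 : eps != 0.
Proof. by apply: contraTneq eps_unit => ->; rewrite unitr0. Qed.
Section EdgeLattice.
Variables (T : lattice 3) (U : 'M[Zp]_3).
Hypotheses (T_int : integral T) (T_frame : frame T (eps * p%:R) U).
Local Notation rt := (rcrd T U).
Let Uu : U \in unitmx. Proof. by case: T_frame. Qed.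

Let c0 : zres (eps * p%:R) = 0.
Proof. by rewrite rmorphM rmorph_nat /= Fres_p // mulr0. Qed.

(** The form x y + eps p z^2 is symmetric in x and y. In the swapped frame the neighbour p | x
    becomes p | y, so that a single kind of edge has to be studied. *)
Lemma frame_swap : exists2 U', frame T (eps * p%:R) U' &
  forall x, carrier T x -> rcrd T U' x 0 i0 = rt x 0 i1 /\ rcrd T U' x 0 i1 = rt x 0 i0.
Proof.
pose R : 'M[Zp]_3 := \matrix_i (if i == i0 then row3 0 1 0 else
  if i == i1 then row3 1 0 0 else row3 0 0 1).
have RE (u : 'rV[Zp]_3) : u *m R = row3 (u 0 i1) (u 0 i0) (u 0 i2).
  rewrite mulmx_sum_row sum3 !rowK /=.
  by apply: row3P; rewrite !mxE /= !(mulr0, mulr1, addr0, add0r).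
have [||||xi||u|U' fU' U'E] := @frame_sub p _ (0 : 'M[F]_(3, 1)) T (eps * p%:R) U
  T 1 R (eps * p%:R).
- exact: pp.
- exact: T_frame.
- by rewrite scale1r.
- by move=> x; rewrite mulmx0; split=> [|[]].
- rewrite mulmx0; split=> // _; exists (row3 (xi 0 i1) (xi 0 i0) (xi 0 i2)).
  by rewrite RE !row3E -row3_eta.
- by rewrite mulf_neq0 // zadic_nat_neq0 // prime_gt0.
- by rewrite rmorph1 mul1r RE /quad !row3E (mulrC (u 0 i1)).
exists U' => // x Tx; rewrite /rcrd (U'E x Tx) RE.
by split; rewrite [LHS]mxE [RHS]mxE row3E.
Qed.

(* In the coordinates of U, N is the sublattice p | y of T, with its form divided
   by p, and V rescales y by 1 / p. *)
Definition edge (N : lattice 3) (V : 'M[Zp]_3) : Prop :=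
  [/\ form N = p%:R^-1 *: form T,
      integral N,
      frame N eps V,
      forall x, carrier N x <-> carrier T x /\ rt x 0 i1 = 0 &
      forall x, carrier N x -> crd T U x =
        row3 (crd N V x 0 i0) (p%:R * crd N V x 0 i1) (crd N V x 0 i2)].

(** Substituting y = p y' in x y + eps p z^2 and dividing by p gives x y' + eps z^2. *)
Lemma edge_exists N : form N = p%:R^-1 *: form T ->
  (forall x, carrier N x <-> carrier T x /\ rt x 0 i1 = 0) ->
  (forall x, carrier N x -> exists m : int, Q T x = (p%:Z * m)%:~R) ->
  exists V, edge N V.
Proof.
move=> Nf Nc Nd.
pose R : 'M[Zp]_3 := \matrix_i (if i == i0 then row3 1 0 0 else
  if i == i1 then row3 0 p%:R 0 else row3 0 0 1).
have RE (u : 'rV[Zp]_3) : u *m R = row3 (u 0 i0) (p%:R * u 0 i1) (u 0 i2).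
  rewrite mulmx_sum_row sum3 !rowK /=.
  by apply: row3P; rewrite !mxE /= !(mulr0, mulr1, addr0, add0r) // mulrC.
have colE (v : 'rV[F]_3) : v *m (delta_mx i1 0 : 'M_(3, 1)) = 0 <-> v 0 i1 = 0.
  rewrite -colE; split=> [/matrixP/(_ 0 0)|v1]; first by rewrite !mxE.
  by apply/matrixP => i j; rewrite !ord1 !mxE.
have [||||xi||u|V fV VE] := @frame_sub p _ (delta_mx i1 0 : 'M[F]_(3, 1)) T
  (eps * p%:R) U N p%:R^-1 R eps.
- exact: pp.
- exact: T_frame.
- exact: Nf.
- by move=> x; rewrite colE.
- rewrite colE mxE; split=> [/eqP/zres_eq0P[y]|[u ->]]; last first.
    by rewrite RE row3E rmorphM rmorph_nat Fres_p // mul0r.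
  rewrite padic_primeE // => yE; exists (row3 (xi 0 i0) y (xi 0 i2)).
  by rewrite RE !row3E -yE -row3_eta.
- exact: eps_neq0.
- rewrite RE /quad !row3E (_ : _ + _ = p%:R * (u 0 i0 * u 0 i1 + eps * u 0 i2 ^+ 2)).
    by rewrite fmorphV rmorphM !rmorph_nat mulKf // qadic_nat_neq0 // prime_gt0.
  by rewrite mulrDr; congr (_ + _); [rewrite mulrCA|rewrite -!mulrA mulrCA].
exists V; split=> // x Nx; last by rewrite (VE x Nx) RE.
have [m mE] := Nd x Nx.
by rewrite /Q (B_formZ _ _ Nf) -/(Q T x) mE rmorphM mulKf //= intr_int.
Qed.

Lemma T_mul_isotropic x (m : int) : carrier T x -> Q T x = (p%:Z * m)%:~R ->
  rt x 0 i0 * rt x 0 i1 = 0.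
Proof.
move=> Tx /(frame_res T_frame Tx); rewrite rmorphM /= -pmulrn Fres_p // mul0r.
by rewrite /quad c0 mul0r addr0 => <-.
Qed.

(** Modulo p the form of T is x y, so each vector of A satisfies p | x or p | y. If neither held
    throughout A, the sum of a vector violating the one and a vector violating the other would
    violate both. *)
Lemma additive_isotropic (A : set 'rV[rat]_3) : A `<=` carrier T ->
  (forall x y, A x -> A y -> A (x + y)) ->
  (forall x, A x -> exists m : int, Q T x = (p%:Z * m)%:~R) ->
  (forall x, A x -> rt x 0 i1 = 0) \/ (forall x, A x -> rt x 0 i0 = 0).
Proof.
move=> AT AD Ad.
have iso x : A x -> rt x 0 i0 * rt x 0 i1 = 0.
  by move=> Ax; have [m /(T_mul_isotropic (AT _ Ax))] := Ad x Ax.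
have [h|/existsNP[x /not_implyP[Ax x1]]] :=
  pselect (forall x, A x -> rt x 0 i1 = 0); first by left.
right=> y Ay; apply: contrapT => y0.
have x0 : rt x 0 i0 = 0 by case: (mulf_eq0_or (iso x Ax)).
have y1 : rt y 0 i1 = 0 by case: (mulf_eq0_or (iso y Ay)).
have := iso _ (AD x y Ax Ay); rewrite (rcrdD U (AT _ Ax) (AT _ Ay)).
move: (rt x) (rt y) x1 x0 y0 y1 => u v u1 u0 v0 v1.
have -> : (u + v) 0 i0 = v 0 i0 by rewrite mxE u0 add0r.
have -> : (u + v) 0 i1 = u 0 i1 by rewrite mxE v1 addr0.
by move/mulf_eq0_or => [].
Qed.

(* If h were in the kernel but not in G, and t has residue 1, then h and the
   k t, k < p, would represent p + 1 cosets of G. *)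
Lemma index_kernel (G : lattice 3) j : index_eq p T G ->
  (forall x, carrier G x -> carrier T x /\ rt x 0 j = 0) ->
  forall x, carrier G x <-> carrier T x /\ rt x 0 j = 0.
Proof.
move=> iG Gj h; split=> [/Gj//|[Th hj]]; apply: contrapT => Gh.
pose coset x := [set x + y | y in carrier G].
have cosetP x y : coset x = coset y -> carrier G (x - y).
  move=> xy; have : coset x x by exists 0; rewrite ?addr0 //; exact: carrier0.
  by rewrite xy => -[z Gz <-]; rewrite addrC addKr.
have [t Tt tE] := rcrd_surj T (\row_k (k == j)%:R : 'rV[F]_3) Uu.
have tj : rt t 0 j = 1 by rewrite tE mxE eqxx.
pose X (k : option 'I_p) := if k is Some k then (k : nat)%:R *: t else h.
have XT k : carrier T (X k) by case: k => [k|] //=; exact: carrier_nat.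
have rX k : rt ((k : nat)%:R *: t) 0 j = k%:R.
  by rewrite rcrd_nat // mxE tj mulr1.
have subE x y : carrier T x -> carrier T y -> rt (x - y) 0 j = rt x 0 j - rt y 0 j.
  move=> Tx Ty; rewrite rcrdD ?rcrdN //; last exact: carrierN.
  by rewrite mxE [X in _ + X]mxE.
have small (k l : nat) : (k < p)%N -> (l < p)%N -> k%:R = l%:R :> F -> k = l.
  move=> kp lp /(congr1 val).
  by rewrite /= !val_Fp_nat ?padic_primeP // padic_primeE // !modn_small.
have inj : injective (coset \o X).
  have main k (l : 'I_p) : coset (X k) = coset (X (Some l)) -> k = Some l.
    move=> /cosetP Gkl; have [_] := Gj _ Gkl.
    rewrite (subE _ _ (XT k) (XT (Some l))) (rX l).
    case: k Gkl => [k|] Gkl; rewrite ?(rX k) ?hj => /eqP; rewrite subr_eq0 => /eqP.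
      by move/small => kl; congr Some; apply/val_inj/kl.
    rewrite -[0]/(0%:R) => /small l0; case: Gh; move: Gkl.
    by rewrite /= -l0 ?prime_gt0 // scale0r subr0.
  move=> [k|] [l|] // e1; [exact: main|exact/esym/main|exact: main].
pose C := [set coset x | x in carrier T].
have fC : finite_set C by exists p.
have := @uniq_leq_size _ (map (coset \o X) (enum {: option 'I_p})) (fset_set C).
rewrite map_inj_uniq // enum_uniq size_map -cardE card_option card_ord.
rewrite (card_fset_set iG) ltnn => /(_ isT) sub.
suff: false by [].
by apply: sub => _ /mapP[k _ ->]; apply/fset_setP => //; exists (X k).
Qed.

End EdgeLattice.
End Edge.

Lemma Fres_Zp p : prime p -> exists phi : Fres p -> 'Z_p,
  [/\ {morph phi : x y / x + y}, forall x, phi x = 0 -> x = 0 &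
      forall z, exists x, phi x = z].
Proof.
move=> pp; have : pdiv (padic_prime p) = p by rewrite padic_primeE // pdiv_id.
(* The type [Fres p] is ['Z_(pdiv (padic_prime p))], whose index equals p only propositionally;
   destructing that equality identifies the two types. *)
move: (pdiv _) => m; case: _ /.
by exists id; split=> // z; exists z.
Qed.

(** * Planes through the image of pT in one neighbour *)

Section EdgeTheory.
Variable p : nat.
Hypothesis pp : prime p.
Local Notation Zp := (Zadic p).
Local Notation F := (Fres p).
Local Notation pt := (@proj_pt F).
Variable eps : Zp.
Hypothesis eps_unit : eps \is a GRing.unit.
Local Notation e := (zres eps).
Variables (T : lattice 3) (U : 'M[Zp]_3).
Hypotheses (T_int : integral T) (T_frame : frame T (eps * p%:R) U).
Variables (N : lattice 3) (V : 'M[Zp]_3).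
Hypothesis TN : edge eps T U N V.
Local Notation rt := (rcrd T U).
Local Notation rc := (rcrd N V).
Local Notation Nab := (plane_lattice eps N V).
Local Notation K t := (Nab None (Some t)).

Let e0 : e != 0. Proof. exact: e_neq0. Qed.
Let p_neq0 : p%:R != 0 :> rat.
Proof. by rewrite pnatr_eq0 -lt0n prime_gt0. Qed.
Let Uu : U \in unitmx. Proof. by case: T_frame. Qed.
Let N_form : form N = p%:R^-1 *: form T. Proof. by case: TN. Qed.
Let N_int : integral N. Proof. by case: TN. Qed.
Let N_frame : frame N eps V. Proof. by case: TN. Qed.
Let Vu : V \in unitmx. Proof. by case: N_frame. Qed.
Let N_carrier x : carrier N x <-> carrier T x /\ rt x 0 i1 = 0.
Proof. by case: TN => _ _ _ h _; exact: h. Qed.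
Let NT : carrier N `<=` carrier T. Proof. by move=> x /N_carrier[]. Qed.

Lemma edge_Q x : Q N x = p%:R^-1 * Q T x.
Proof. exact: B_formZ N_form. Qed.

Lemma edge_rcrd x : carrier N x -> rt x = row3 (rc x 0 i0) 0 (rc x 0 i2).
Proof.
move=> Nx; have [_ _ _ _ h] := TN.
have cE M' V' j : rcrd M' V' x 0 j = zres (crd M' V' x 0 j) by rewrite [LHS]mxE.
apply: row3P; rewrite row3E !cE (h x Nx) row3E //.
by rewrite rmorphM rmorph_nat Fres_p // mul0r.
Qed.

Lemma edge_mulp x : carrier T x -> carrier N (p%:R *: x).
Proof.
move=> Tx; apply/N_carrier; split; first exact: carrier_nat.
by rewrite rcrd_nat // Fres_p // scale0r mxE.
Qed.

(** Identifies pT as the preimage of the line [None] of N / pN. *)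
Lemma edge_line x : carrier N x ->
  (rc x 0 i0 = 0 /\ rc x 0 i2 = 0) <-> exists2 y, carrier T y & x = p%:R *: y.
Proof.
move=> Nx; rewrite -(rcrd_eq0 pp Uu (NT Nx)) edge_rcrd //.
split=> [[-> ->]|/matrixP h]; first by apply: row3P; rewrite row3E [RHS]mxE.
by split; [have := h 0 i0|have := h 0 i2]; rewrite row3E => ->; rewrite [LHS]mxE.
Qed.

Lemma edge_up : exists2 x, carrier T x & rc (p%:R *: x) = row3 0 1 0.
Proof.
have [x Tx xE] := rcrd_surj T (row3 0 1 0 : 'rV[F]_3) Uu.
exists x => //; have Npx := edge_mulp Tx.
have [r0 r2] := (edge_line Npx).2 (ex_intro2 _ _ x Tx erefl).
have [_ _ _ _ /(_ _ Npx) h] := TN.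
have r1 : rc (p%:R *: x) 0 i1 = 1.
  have : p%:R * crd N V (p%:R *: x) 0 i1 = p%:R * crd T U x 0 i1.
    have /matrixP/(_ 0 i1) := h; rewrite row3E => <-.
    by rewrite crd_nat // mxE.
  move/mulfI; rewrite zadic_nat_neq0 ?prime_gt0 // => /(_ isT) h1.
  have /matrixP/(_ 0 i1) := xE; rewrite row3E => <-.
  by rewrite /rcrd mxE [RHS]mxE h1.
by apply: row3P; rewrite row3E.
Qed.

(** The bijection is y -> p y from T, where Q_N(p y) = p^-1 p^2 Q_T(y) = p Q_T(y). *)
Lemma cnt_edge_line (k : int) :
  cnt [set x | (carrier N x /\ Q N x = (p%:Z * k)%:~R) /\
               rc x 0 i0 = 0 /\ rc x 0 i2 = 0] = r k T.
Proof.
rewrite /r -(@cnt_image _ _ (fun x => p%:R *: x) [set x | carrier T x /\ _]).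
- congr (cnt _); apply/seteqP; split=> x /=.
    move=> [[Nx Qx] /(edge_line Nx)[y Ty xE]]; exists y => //; split=> //.
    move: Qx; rewrite xE edge_Q QZ rmorphM /= -pmulrn mulrA expr2 mulrA mulVf // mul1r.
    by move/(mulfI p_neq0).
  move=> [y [Ty Qy] <-]; have Npy := edge_mulp Ty; split; last first.
    by apply/(edge_line Npy); exists y.
  split=> //; rewrite edge_Q QZ Qy rmorphM /= -pmulrn mulrA expr2 mulrA mulVf //.
  by rewrite mul1r.
- exact: finite_sphere.
- by move=> x y _ _; exact: scalerI.
Qed.

Lemma sum_r_edge (k : int) :
  (\sum_(t : F) r (p%:Z * k) (K t) = r (p%:Z * k) N + (p - 1) * r k T)%N.
Proof. by rewrite -cnt_edge_line; exact: sum_r_planes_line. Qed.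

(** A vector telling the 2p planes apart: being on the line [Some t], it is in no other [K t'], and
    as its x-coordinate is 1 modulo p, it is outside the other neighbour. *)
Lemma edge_plane_witness t : exists x, [/\ carrier (K t) x, carrier N x,
  rc x = conic e (pt (Some t)) & rt x 0 i0 = 1].
Proof.
have [x Nx xE] := rcrd_surj N (conic e (pt (Some t))) Vu.
exists x; split=> //.
  by apply/(plane_carrier_conic eps_unit None (Some t) Nx xE); rewrite eqxx orbT.
by rewrite edge_rcrd // row3E xE row3E /= expr1n.
Qed.

Lemma edge_plane_inj t t' : carrier (K t) = carrier (K t') -> t = t'.
Proof.
move=> tt'; have [x [Kx Nx xE _]] := edge_plane_witness t.
rewrite tt' in Kx; apply/eqP.
by have := (plane_carrier_conic eps_unit None (Some t') Nx xE).1 Kx.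
Qed.

Section Representations.
Variables (S : lattice 3) (W : 'M[Zp]_3).
Hypotheses (S_int : integral S) (S_frame : frame S (eps * p%:R ^+ 2) W).

Let pS_form : form (scale p%:R S) = p%:R *: form S.
Proof. by rewrite scaleE // ltr0n prime_gt0. Qed.

Lemma representation_plane X : preserves_form (scale p%:R S) T X ->
  image_lattice X S `<=` carrier N ->
  (forall x, carrier T x -> image_lattice X S (p%:R *: x)) ->
  exists t, isometries S (K t) X.
Proof.
move=> Xf XN pX.
have [||a [b [ab abX]]] := image_plane pp eps_unit N_frame S_int S_frame _ XN.
- move=> x y; rewrite (B_formZ _ _ N_form) Xf (B_formZ _ _ pS_form).
  by rewrite mulKf.
- by move=> x /NT; exact: pX.
(* The image contains pT, hence a vector with residue (0, 1, 0) on the line [None]; so [None] is one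
   of the two lines of the plane. *)
have [x Tx xE] := edge_up.
have : carrier (Nab a b) (p%:R *: x) by rewrite -abX.2; exact: pX.
move=> /plane_carrier[_]; rewrite xE /plane !row3E !(mulr0, addr0, add0r, mulr1).
case: a b ab abX => [s|] [t|] // _ abX.
- by exists s; rewrite isometries_planeC.
- by exists t.
Qed.

(** For the quotient: the residue of y cuts N out of T, and on N the linear form of the plane is e
    (z - t x). The pair of residues y and z - t x is thus onto with kernel [K t]. *)
Lemma plane_representation t X : isometries S (K t) X ->
  representations (scale p%:R S) T X /\
  quotient_ZpxZp p T (image_lattice X (scale p%:R S)).
Proof.
move=> [Xf Xc].
have imE : image_lattice X (scale p%:R S) = carrier (K t) by rewrite -Xc.
split.
  split; last by rewrite imE => x /plane_sub /NT.
  move=> x y; rewrite (B_formZ _ _ pS_form) -Xf (B_form (plane_form eps N V _ _)).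
  by rewrite (B_formZ _ _ N_form) mulVKf.
have [phi [phiD phi0 phiS]] := Fres_Zp pp.
have phi00 : phi 0 = 0.
  by apply: (addIr (phi 0)); rewrite add0r -phiD addr0.
exists (fun x => (phi (rt x 0 i1), phi (rt x 0 i2 - t * rt x 0 i0))); split.
- move=> x y Tx Ty; rewrite (rcrdD U Tx Ty).
  move: (rt x) (rt y) => u v.
  have addE i : (u + v) 0 i = u 0 i + v 0 i by rewrite mxE.
  rewrite !addE mulrDr opprD addrACA !phiD //.
- move=> [z1 z2]; have [y1 <-] := phiS z1; have [y2 <-] := phiS z2.
  have [x Tx xE] := rcrd_surj T (row3 0 y1 y2) Uu; exists x => //.
  by rewrite xE !row3E mulr0 subr0.
- move=> x Tx; rewrite imE.
  have planeE y : carrier N y -> plane e (pt None) (pt (Some t)) (rc y) =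
      e * (rt y 0 i2 - t * rt y 0 i0).
    by move=> Ny; rewrite edge_rcrd // !row3E /plane /=; ring.
  split=> [[h1 h2]|/plane_carrier[Nx]].
    have Nx : carrier N x by apply/N_carrier; split=> //; exact: phi0.
    by apply/plane_carrier; split=> //; rewrite planeE // (phi0 _ h2) mulr0.
  rewrite planeE // => /mulf_eq0_or[/eqP|->]; first by rewrite (negbTE e0).
  by have [_ ->] := (N_carrier x).1 Nx; rewrite phi00.
Qed.

End Representations.

Lemma edge_isometric_at q L' : prime q -> q != p -> isometric_at q T (scale p%:R L') ->
  Zadic_equiv (gram_at q N) (gram_at q L').
Proof.
move=> pq qp TL.
apply: (Zadic_equiv_trans (sublattice_at pp pq qp N_form NT edge_mulp)).
have := Zadic_equivZ (qemb q p%:R^-1) TL.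
rewrite gram_at_scale ?ltr0n ?prime_gt0 // scalerA -rmorphM mulVf // rmorph1.
by rewrite scale1r.
Qed.

End EdgeTheory.

(** * Class sums over the genus of S and the final identity *)

Lemma isometries_scale n (a : rat) (M : lattice n) : 0 < a ->
  isometries (scale a M) (scale a M) = isometries M M.
Proof.
move=> a0; have BE := B_formZ _ _ (scaleE M a0).
apply/seteqP; split=> X [Xf Xc]; split=> // x y; last by rewrite !BE Xf.
by have := Xf x y; rewrite !BE => /mulfI; apply; rewrite gt_eqF.
Qed.

Lemma sumrB_natr (R : pzRingType) (J : finType) (c d : R) (f g : J -> nat) :
  \sum_j (c * (f j)%:R - d * (g j)%:R) =
  c * (\sum_j f j)%:R - d * (\sum_j g j)%:R.
Proof. by rewrite sumrB !natr_sum !mulr_sumr. Qed.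

Section Sums.
Variable p : nat.
Hypothesis pp : prime p.
Local Notation Zp := (Zadic p).
Local Notation F := (Fres p).
Local Notation I := (option F).
Variable eps : Zp.
Hypothesis eps_unit : eps \is a GRing.unit.
Variables L T S : lattice 3.
Hypotheses (T_in : calG L eps 1 T) (S_in : calG L eps 2 S).

Let p_neq0 : p%:R != 0 :> rat.
Proof. by rewrite pnatr_eq0 -lt0n prime_gt0. Qed.
Let T_int : integral T. Proof. by case: T_in. Qed.

Lemma genus_frame S' : genus S S' -> integral S' /\
  exists W, frame S' (eps * p%:R ^+ 2) W.
Proof.
move=> [Si SS]; split=> //; apply/locally_hyp_frame.
have [_ Sp _] := S_in.
exact: Zadic_equiv_trans (SS p pp) Sp.
Qed.

Section OneEdge.
Variables (U : 'M[Zp]_3) (N : lattice 3) (V : 'M[Zp]_3).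
Hypotheses (T_frame : frame T (eps * p%:R) U) (TN : edge eps T U N V).
Local Notation Nab := (plane_lattice eps N V).

Let N_int : integral N. Proof. by case: TN. Qed.
Let N_frame : frame N eps V. Proof. by case: TN. Qed.

(** At p this is [plane_frame]. At another prime the plane sublattice, N and L have isometric
    completions, and L is isometric to L^(p^2) because p is a unit there. *)
Lemma plane_genus a b : a != b -> genus S (Nab a b).
Proof.
move=> ab; split; first exact: plane_integral.
have [_ Sp Sq] := S_in; have [_ _ Tq] := T_in.
move=> ell ellP; have [->|ellp] := eqVneq ell p.
  have /locally_hyp_frame h := plane_frame pp eps_unit N_frame ab.
  exact: Zadic_equiv_trans h (Zadic_equiv_sym Sp).
have e1 := sublattice_at pp ellP ellp (etrans (plane_form eps N V a b) (esym (scale1r _)))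
  (@plane_sub _ eps N V a b) (@plane_mulp _ pp eps N V a b).
rewrite rmorph1 scale1r in e1.
apply: (Zadic_equiv_trans e1).
have e2 := edge_isometric_at pp TN ellP ellp (Tq _ ellP ellp).
apply: (Zadic_equiv_trans e2).
apply: Zadic_equiv_sym; apply: (Zadic_equiv_trans (Sq _ ellP ellp)).
rewrite gram_at_scale ?exprn_gt0 ?ltr0n ?prime_gt0 //.
apply: Zadic_equiv_sym; rewrite rmorphXn rmorph_nat -[p%:R](rmorph_nat (@FracField.tofrac (Zadic ell))).
exact/Zadic_equiv_sqr/natr_unit_zadic.
Qed.

Lemma lambda_class_sum (k : int) :
  (o N)%:R * class_sum S
     [set S' | genus S S' /\ isometric (lambda p S') N]
     (fun S' => (r k S')%:R / (o S')%:R)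
  = (\sum_(ab : I * I | rank_lt ab) r k (Nab ab.1 ab.2))%:R.
Proof.
have oN : (o N)%:R != 0 :> rat by rewrite pnatr_eq0 -lt0n o_gt0.
rewrite (@class_sumE _ _ _ _ (@rank_lt I) (fun ab => Nab ab.1 ab.2) _
  (fun M => (r k M)%:R / (o N)%:R)).
- by rewrite -mulr_suml mulrC divfK // natr_sum.
- move=> [a b] /rank_lt_neq ab; split; first exact: plane_genus.
  have [W fW] := plane_frame pp eps_unit N_frame ab.
  (* By [isometries_lambda], the identity of the plane sublattice divided by p maps its lambda_p
     onto N. *)
  exists (p%:R^-1 *: 1%:M).
  have Ki : integral (Nab a b) by exact: plane_integral.
  apply: (isometries_lambda pp eps_unit N_int N_frame Ki fW _).2.
  by exists a, b; rewrite scalerA divff // scale1r; split=> //; exact: isometries_id.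
move=> S' [/genus_frame[S'i [W fW]] lN].
have oS : (o S')%:R != 0 :> rat by rewrite pnatr_eq0 -lt0n o_gt0.
have [X lNX] := lN.
have := cnt_isometries_lambda pp eps_unit N_int N_frame S'i fW.
(* Now [oE] expresses o(N) as the sum, over the planes, of the number of isometries from S', each
   summand being o(S') or 0. *)
rewrite (cnt_isometries lNX) (o_isometric lN) => oE.
apply: (mulfI oN); rewrite {1}oE natr_sum mulr_suml mulr_sumr.
apply: eq_bigr => ab _; rewrite cnt_isometriesE.
case: asboolP => [SK|_]; last by rewrite mul0r mulr0.
by rewrite (r_isometric k SK) mulrCA divff // mulr1 mulrCA divff // mulr1.
Qed.

End OneEdge.

Lemma sum_edge_planes U N V : frame T (eps * p%:R) U -> edge eps T U N V ->
  forall (c d : rat) (n : int),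
  \sum_(t : F) (c * (r (p%:Z * n) (plane_lattice eps N V None (Some t)))%:R
    - d * (r (p%:Z ^+ 3 * n) (plane_lattice eps N V None (Some t)))%:R)
  = c * (r (p%:Z * n) N + (p - 1) * r n T)%N%:R
    - d * (r (p%:Z ^+ 3 * n) N + (p - 1) * r (p%:Z ^+ 2 * n) T)%N%:R.
Proof.
move=> fU TN c d n; rewrite -(sum_r_edge pp eps_unit fU TN n).
have -> : p%:Z ^+ 3 * n = p%:Z * (p%:Z ^+ 2 * n) by rewrite mulrA -exprS.
rewrite -(sum_r_edge pp eps_unit fU TN (p%:Z ^+ 2 * n)).
exact: sumrB_natr.
Qed.

Section TwoEdges.
Variables (U1 U2 : 'M[Zp]_3).
Hypotheses (T_frame1 : frame T (eps * p%:R) U1) (T_frame2 : frame T (eps * p%:R) U2).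
Hypothesis U12 : forall x, carrier T x ->
  rcrd T U2 x 0 i0 = rcrd T U1 x 0 i1 /\ rcrd T U2 x 0 i1 = rcrd T U1 x 0 i0.
Variables (N1 N2 : lattice 3) (V1 V2 : 'M[Zp]_3).
Hypotheses (TN1 : edge eps T U1 N1 V1) (TN2 : edge eps T U2 N2 V2).
Local Notation K1 t := (plane_lattice eps N1 V1 None (Some t)).
Local Notation K2 t := (plane_lattice eps N2 V2 None (Some t)).
Local Notation K it := (if it.1 then K1 it.2 else K2 it.2).

(** The image of S'^p has all norms divisible by p, hence lies in N1 or N2 by [additive_isotropic];
    there [representation_plane] finds the plane. The planes are pairwise distinct, so no
    representation is counted twice. *)
Lemma cnt_representations S' : genus S S' ->
  r_tilde p (scale p%:R S') T = (\sum_(it : bool * F) cnt (isometries S' (K it)))%N.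
Proof.
move=> /genus_frame[S'i [W fW]]; rewrite /r_tilde.
apply: cnt_bigU => [it _|X|[i t] [j s] X /= _ _].
- exact: finite_isometries.
- split=> [[[Xf Xc] [f [fD _ f0]]]|[[[] t] _ /= h]]; last 2 first.
  + exact: (plane_representation pp eps_unit T_frame1 TN1 h).
  + exact: (plane_representation pp eps_unit T_frame2 TN2 h).
  have Tx x : carrier S' x -> carrier T (x *m X) by move=> Sx; apply: Xc; exists x.
  (* The quotient Z/p + Z/p is killed by p, so the image contains pT. *)
  have pX x : carrier T x -> image_lattice X S' (p%:R *: x).
    move=> Tx'; apply/(f0 _ (carrier_nat p Tx')).
    have fk k : f (k%:R *: x) = f x *+ k.
      elim: k => [|k IHk].
        rewrite scale0r mulr0n; apply: (addIr (f 0)).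
        by rewrite add0r -fD ?addr0 //; exact: carrier0.
      by rewrite -(addn1 k) natrD scalerDl scale1r fD ?IHk ?mulrS ?addn1 ?mulrSr //; exact: carrier_nat.
    rewrite fk.
    have Zp0 (z : 'Z_p) : z *+ p = 0 by rewrite -mulr_natr pchar_Zp ?mulr0 // prime_gt1.
    by rewrite pairMnE !Zp0.
  have pf : form (scale p%:R S') = p%:R *: form S' by rewrite scaleE // ltr0n prime_gt0.
  have [|||h|h] := @additive_isotropic p pp eps T U1 T_frame1 (image_lattice X S').
  + by move=> _ [x Sx <-]; exact: Tx.
  + by move=> _ _ [x Sx <-] [y Sy <-]; exists (x + y); rewrite ?mulmxDl //; exact: carrierD.
  + move=> _ [x Sx <-]; exists (numq (Q S' x)).
    by rewrite /Q Xf (B_formZ _ _ pf) -/(Q S' x) {1}(Q_numq S'i Sx) rmorphM.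
  + have [|t ht] := representation_plane pp eps_unit T_frame1 TN1 S'i fW Xf _ pX.
      move=> x Xx; have [_ _ _ Nc _] := TN1; apply/Nc; split; last exact: h.
      by case: Xx => y Sy <-; exact: Tx.
    by exists (true, t).
  + have [|t ht] := representation_plane pp eps_unit T_frame2 TN2 S'i fW Xf _ pX.
      move=> x Xx; have [_ _ _ Nc _] := TN2; apply/Nc.
      have Txx : carrier T x by case: Xx => y Sy <-; exact: Tx.
      by split=> //; rewrite (U12 Txx).2; exact: h.
    by exists (false, t).
have [_ _ _ Nc1 _] := TN1; have [_ _ _ Nc2 _] := TN2.
have one0 : (1 : F) <> 0 by apply/eqP; exact: oner_neq0.
case: i; case: j => -[_ h] -[_ h'].
- by congr pair; apply: (edge_plane_inj pp eps_unit TN1); rewrite -h -h'.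
- have [x [Kx _ _ x1]] := edge_plane_witness pp eps_unit TN1 t.
  by move: Kx; rewrite -h h' => /plane_sub/Nc2[Tx]; rewrite (U12 Tx).2 x1 => /one0.
- have [x [Kx _ _ x1]] := edge_plane_witness pp eps_unit TN2 t.
  by move: Kx; rewrite -h h' => /plane_sub/Nc1[Tx]; rewrite -(U12 Tx).1 x1 => /one0.
- by congr pair; apply: (edge_plane_inj pp eps_unit TN2); rewrite -h -h'.
Qed.

Lemma representations_class_sum (g : lattice 3 -> rat) :
  (forall M M', isometric M M' -> g M = g M') ->
  class_sum S (genus S) (fun S' =>
      (r_tilde p (scale p%:R S') T)%:R / (o S')%:R * g S')
  = \sum_(t : F) g (K1 t) + \sum_(t : F) g (K2 t).
Proof.
move=> gI; rewrite (@class_sumE _ _ _ _ xpredT (fun it => K it) _ g).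
- rewrite -(pair_big xpredT xpredT (fun i t => g (K (i, t)))) /=.
  by rewrite big_bool.
- move=> [[] t] _; [exact: (plane_genus TN1)|exact: (plane_genus TN2)].
move=> S' S'g; rewrite (cnt_representations S'g) natr_sum !mulr_suml.
have oS : (o S')%:R != 0 :> rat by rewrite pnatr_eq0 -lt0n o_gt0.
apply: eq_bigr => it _; rewrite cnt_isometriesE.
case: asboolP => [/gI ->|_]; last by rewrite !mul0r.
by rewrite divff // mul1r.
Qed.

(* A vector of T of norm divisible by p^2 lies in N1 or in N2, and in both
   only if it lies in pT. *)
Lemma r_two_edges (n : int) :
  (r (p%:Z ^+ 2 * n) T + r n T = r (p%:Z * n) N1 + r (p%:Z * n) N2)%N.
Proof.
pose D := [set x | carrier T x /\ Q T x = (p%:Z ^+ 2 * n)%:~R].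
have fD : finite_set D by exact: finite_sphere.
have Uu : U1 \in unitmx by case: T_frame1.
have rN N U V : frame T (eps * p%:R) U -> edge eps T U N V -> r (p%:Z * n) N
    = (\sum_(x <- fset_set D) (rcrd T U x 0%R i1 == 0%R))%N.
  move=> fU TN; have [Nf _ _ Nc _] := TN.
  rewrite /r (_ : [set x | _ /\ _] = [set x | D x /\ rcrd T U x 0 i1 = 0]).
    rewrite (cntE fD); last by move=> x [].
    apply: eq_big_seq => x /(fset_setP _ fD) Dx; congr nat_of_bool.
    by apply/asboolP/eqP => [[]|].
  have QE x : Q N x = (p%:Z * n)%:~R <-> Q T x = (p%:Z ^+ 2 * n)%:~R.
    rewrite (edge_Q TN) rmorphM rmorphM rmorphXn /= -pmulrn expr2 -mulrA.
    by split=> [<-|->]; [rewrite mulVKf|rewrite mulKf].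
  apply/seteqP; split=> x /=.
    by move=> [/Nc[Tx x1] /QE Qx].
  by move=> [[Tx Qx] x1]; split; [apply/Nc|apply/QE].
rewrite (rN _ _ _ T_frame1 TN1) (rN _ _ _ T_frame2 TN2).
(* Vectors of norm n in T are counted as the vectors of pT of norm p^2 n. *)
have -> : r n T = (\sum_(x <- fset_set D) (rcrd T U1 x == 0%R))%N.
  rewrite -(r_mulp pp T_frame1) (cntE fD); last by move=> x [].
  apply: eq_big_seq => x /(fset_setP _ fD) Dx; congr nat_of_bool.
  by apply/asboolP/eqP => [[]|].
rewrite /r card_fset_sum1 -!big_split /=; apply: eq_big_seq => x /(fset_setP _ fD)[Tx Qx].
rewrite (U12 Tx).2.
have iso : rcrd T U1 x 0 i0 * rcrd T U1 x 0 i1 = 0.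
  by apply: (T_mul_isotropic pp T_frame1 Tx (m := p%:Z * n)); rewrite Qx mulrA -expr2.
(* If x = p x' and y = p y', then eps p z^2 = p^2 (n - x' y'), so p divides z as well. *)
have -> : (rcrd T U1 x == 0) = (rcrd T U1 x 0 i0 == 0) && (rcrd T U1 x 0 i1 == 0).
  apply/eqP/andP => [->|[/eqP x0 /eqP x1]]; first by rewrite !mxE eqxx.
  apply: row3P; rewrite [RHS]mxE //.
  have rE i : rcrd T U1 x 0 i = zres (crd T U1 x 0 i) by rewrite [LHS]mxE.
  move: x0 x1; rewrite !rE => /eqP/zres_eq0P[y0 y0E] /eqP/zres_eq0P[y1 y1E].
  rewrite !padic_primeE // in y0E y1E.
  have := frame_Q T_frame1 Tx Qx; rewrite /quad y0E y1E.
  rewrite rmorphM rmorphXn /= -pmulrn => qE.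
  have pZ : p%:R != 0 :> Zp by rewrite zadic_nat_neq0 // prime_gt0.
  have : eps * crd T U1 x 0 i2 ^+ 2 = p%:R * (n%:~R - y0 * y1).
    apply: (mulfI pZ); move: (n%:~R) (crd T U1 x 0 i2) qE => m z qE.
    have -> : p%:R * (p%:R * (m - y0 * y1)) = p%:R ^+ 2 * m - p%:R * y0 * (p%:R * y1).
      by ring.
    by rewrite qE; ring.
  move/(congr1 (@zres p)); rewrite !rmorphM /= rmorph_nat Fres_p // mul0r.
  move/mulf_eq0_or => [/eqP|/mulf_eq0_or[]//].
  by rewrite (negbTE (e_neq0 eps_unit)).
by case/mulf_eq0_or: iso => ->; rewrite eqxx ?andbT //; case: (_ == 0).
Qed.

End TwoEdges.

(** A sublattice of index p with norms divisible by p is p | x or p | y. Two different ones are one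
    of each, and the one given by p | x is read in the swapped frame. *)
Lemma Gamma_edges U G1 G2 : frame T (eps * p%:R) U ->
  is_Gamma p T G1 -> is_Gamma p T G2 -> carrier G1 <> carrier G2 ->
  exists U1 U2 V1 V2,
    [/\ frame T (eps * p%:R) U1, frame T (eps * p%:R) U2,
      forall x, carrier T x ->
        rcrd T U2 x 0 i0 = rcrd T U1 x 0 i1 /\ rcrd T U2 x 0 i1 = rcrd T U1 x 0 i0,
      edge eps T U1 (scale p%:R^-1 G1) V1 & edge eps T U2 (scale p%:R^-1 G2) V2].
Proof.
move=> fU GG1 GG2 G12; have [U' fU' UU'] := frame_swap pp eps_unit fU.
have kernel G : is_Gamma p T G ->
    (forall x, carrier G x <-> carrier T x /\ rcrd T U x 0 i1 = 0) \/
    (forall x, carrier G x <-> carrier T x /\ rcrd T U x 0 i0 = 0).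
  move=> [Gf GT iG Gd].
  have Gd' x : carrier G x -> exists m : int, Q T x = (p%:Z * m)%:~R by exact: Gd.
  have [h|h] := additive_isotropic pp fU GT (@carrierD _ G) Gd'; [left|right];
    by apply: (index_kernel pp fU iG) => x Gx; split; [exact: GT|exact: h].
have edgeP W G : frame T (eps * p%:R) W -> is_Gamma p T G ->
    (forall x, carrier G x <-> carrier T x /\ rcrd T W x 0 i1 = 0) ->
    exists V, edge eps T W (scale p%:R^-1 G) V.
  move=> fW [Gf _ _ Gd] Gc; apply: edge_exists => //.
  by rewrite scaleE ?Gf // invr_gt0 ltr0n prime_gt0.
have swapP G : (forall x, carrier G x <-> carrier T x /\ rcrd T U x 0 i0 = 0) ->
    (forall x, carrier G x <-> carrier T x /\ rcrd T U' x 0 i1 = 0).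
  by move=> h x; rewrite h; split=> -[Tx]; rewrite (UU' x Tx).2.
case: (kernel _ GG1) => h1; case: (kernel _ GG2) => h2.
- by case: G12; apply/seteqP; split=> x; rewrite h1 h2.
- have [V1 E1] := edgeP _ _ fU GG1 h1; have [V2 E2] := edgeP _ _ fU' GG2 (swapP _ h2).
  by exists U, U', V1, V2.
- have [V1 E1] := edgeP _ _ fU' GG1 (swapP _ h1); have [V2 E2] := edgeP _ _ fU GG2 h2.
  by exists U', U, V1, V2; split=> // x Tx; have [-> ->] := UU' x Tx.
- by case: G12; apply/seteqP; split=> x; rewrite h1 h2.
Qed.

End Sums.

(** Here a = r(n, T), b = r(p^2 n, T), x_i = r(pn, N_i) and y_i = r(p^3 n, N_i). The factor p / (p -
    1) cancels the y_i against C1 and C2. The x_i then have coefficient 3p/2 + p/2 = 2p and b has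
    -2p, so b + a = x1 + x2 leaves 3p (p - 1) a + 2p a = (3p^2 - p) a. *)
Lemma arith_two_edges (p a b x1 x2 y1 y2 C1 C2 : nat) : (1 < p)%N ->
  (2 * C1 = 2 * p * y1 + (p ^ 2 - p) * x1)%N ->
  (2 * C2 = 2 * p * y2 + (p ^ 2 - p) * x2)%N ->
  (b + a = x1 + x2)%N ->
  (3 * p%:R ^+ 2 - p%:R) * a%:R =
  3 * p%:R / 2 * (x1 + (p - 1) * a)%N%:R - p%:R / (p%:R - 1) * (y1 + (p - 1) * b)%N%:R
  + (3 * p%:R / 2 * (x2 + (p - 1) * a)%N%:R - p%:R / (p%:R - 1) * (y2 + (p - 1) * b)%N%:R)
  + 1 / (p%:R - 1) * (C1%:R + C2%:R) :> rat.
Proof.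
move=> p1.
have pp : (p <= p ^ 2)%N by rewrite -mulnn leq_pmulr // ltnW.
move=> /(congr1 (fun k => k%:R : rat)) + /(congr1 (fun k => k%:R : rat)) +
       /(congr1 (fun k => k%:R : rat)).
rewrite !(natrD, natrM, natrB, natrX) // 1?ltnW //.
have : (p%:R : rat) - 1 != 0 by rewrite subr_eq0 pnatr_eq1 gtn_eqF.
move: (p%:R : rat) (a%:R : rat) (b%:R : rat) (x1%:R : rat) (x2%:R : rat) (y1%:R : rat)
  (y2%:R : rat) (C1%:R : rat) (C2%:R : rat).
move=> u A D X1 X2 Y1 Y2 E1 E2 u1 c1 c2 AD.
have -> : E1 = u * Y1 + (u ^+ 2 - u) * X1 / 2 by lra.
have -> : E2 = u * Y2 + (u ^+ 2 - u) * X2 / 2 by lra.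
have -> : D = X1 + X2 - A by lra.
by field.
Qed.

Theorem theorem4p7 (p : nat) (p_prime : prime p)
    (L : lattice 3) (L_int : integral L)
    (eps : Zadic p) (eps_unit : eps \is a GRing.unit) (L_p : locally_hyp L eps)
    (T S : lattice 3) (T_in : calG L eps 1 T) (S_in : calG L eps 2 S)
    (TS : r_lat (scale p%:R T) S <> 0%N)
    (G1 G2 : lattice 3) (G1_Gamma : is_Gamma p T G1) (G2_Gamma : is_Gamma p T G2)
    (G12 : carrier G1 <> carrier G2)
    (n : int) :
  (3 * p%:R ^+ 2 - p%:R) * (r n T)%:R =
    class_sum S (genus S) (fun S' =>
      (r_tilde p (scale p%:R S') T)%:R / (o S')%:R
      * (3 * p%:R / 2 * (r (p%:Z * n) S')%:R
         - p%:R / (p%:R - 1) * (r (p%:Z ^+ 3 * n) S')%:R))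
    + 1 / (p%:R - 1) *
      ((o G1)%:R * class_sum S
         [set S' | genus S S' /\ isometric (lambda p S') (scale p%:R^-1 G1)]
         (fun S' => (r (p%:Z ^+ 3 * n) S')%:R / (o S')%:R)
       + (o G2)%:R * class_sum S
         [set S' | genus S S' /\ isometric (lambda p S') (scale p%:R^-1 G2)]
         (fun S' => (r (p%:Z ^+ 3 * n) S')%:R / (o S')%:R)).
Proof.
have [U fU] : exists U, frame T (eps * p%:R) U by apply/locally_hyp_frame; case: T_in.
have [U1 [U2 [V1 [V2 [fU1 fU2 U12 E1 E2]]]]] :=
  Gamma_edges p_prime eps_unit fU G1_Gamma G2_Gamma G12.
have pV : 0 < p%:R^-1 :> rat by rewrite invr_gt0 ltr0n prime_gt0.
have oG (G : lattice 3) : o G = o (scale p%:R^-1 G) by rewrite /o isometries_scale.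
rewrite (oG G1) (oG G2).
rewrite (lambda_class_sum p_prime eps_unit T_in S_in E1).
rewrite (lambda_class_sum p_prime eps_unit T_in S_in E2).
pose g (S' : lattice 3) : rat := 3 * p%:R / 2 * (r (p%:Z * n) S')%:R
         - p%:R / (p%:R - 1) * (r (p%:Z ^+ 3 * n) S')%:R.
rewrite (representations_class_sum p_prime eps_unit T_in S_in fU1 fU2 U12 E1 E2
  (g := g)); last first.
  by move=> M M' MM'; rewrite /g !(r_isometric _ MM').
have s1 := sum_edge_planes p_prime eps_unit fU1 E1.
have s2 := sum_edge_planes p_prime eps_unit fU2 E2.
have p1 := prime_gt1 p_prime.
have [_ _ N1f _ _] := E1; have [_ _ N2f _ _] := E2.
have c1 := sum_r_planes p_prime eps_unit N1f n.
have c2 := sum_r_planes p_prime eps_unit N2f n.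
have c3 := r_two_edges p_prime eps_unit fU1 fU2 U12 E1 E2 n.
apply: (etrans (arith_two_edges p1 c1 c2 c3)); congr (_ + _).
by congr (_ + _); apply: esym; [exact: s1|exact: s2].
Qed.
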